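(* For every fixed $\varepsilon>0$ there is a deterministic algorithm which, given a ground set $E$ of size $n$, a monotone submodular function $f:2^{E}\to\mathbb{R}_{\ge 0}$ with curvature $\kappa_f\in[0,1]$ (accessed through a value oracle), and a matroid $\mathcal{M}=(E,\mathcal{I})$ (accessed through an independence oracle), runs in time polynomial in $n$ and outputs a set $S\in\mathcal{I}$ satisfying $$f(S)\;\ge\;\Bigl(1-\frac{\kappa_f}{e}-\varepsilon\Bigr)\cdot\max\{f(T): T\in\mathcal{I}\}.$$
   Context: A set function $f:2^{E}\to\mathbb{R}_{\ge 0}$ is submodular if $f(S)+f(T)\ge f(S\cup T)+f(S\cap T)$ for all $S,T\subseteq E$, and monotone if $f(S)\le f(T)$ whenever $S\subseteq T$. For $e\in E$ write $f(e)=f(\{e\})$ and $S+e=S\cup\{e\}$. The curvature of a monotone submodular $f$ is $\kappa_f = 1-\min_{S\subseteq E,\ e\in E\setminus S,\ f(e)>0}\frac{f(S+e)-f(S)}{f(e)}$. The problem is to maximize $f(S)$ over independent sets $S\in\mathcal{I}$ of the matroid. *)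

(* Defs.v *)
From HB Require Import structures.
From mathcomp Require Import all_boot all_order all_algebra.
From mathcomp Require Import reals.

Set Implicit Arguments.
Unset Strict Implicit.
Unset Printing Implicit Defensive.

Import Order.TTheory GRing.Theory Num.Theory.

Local Open Scope ring_scope.

Section SetFunctions.
Variables (R : realType) (E : finType).
Implicit Types (f : {set E} -> R) (S T : {set E}).

Definition submodular f := forall S T, f (S :|: T) + f (S :&: T) <= f S + f T.

Definition monotone f := forall S T, S \subset T -> f S <= f T.

(* For f >= 0 every ratio with S = set0 is at most 1, so the initial value 1
   of the iterated minimum matters only when f {e} = 0 for all e, where the
   minimum is over an empty family; the curvature is then 0. *)
Definition curvature f : R :=
  1 - \big[Num.min/1]_(p : {set E} * E | (p.2 \notin p.1) && (0 < f [set p.2]))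
        ((f (p.2 |: p.1) - f p.1) / f [set p.2]).

Lemma curvature_bounds f : monotone f -> 0 <= curvature f <= 1.
Proof.
move=> fmon; rewrite /curvature subr_ge0 lerBlDl lerDr; apply/andP; split.
  exact: bigmin_le_id.
apply: le_bigmin => // -[S e] /= /andP[_ fe].
by rewrite divr_ge0 ?subr_ge0 ?(ltW fe) // fmon // subsetUr.
Qed.

End SetFunctions.

Record matroid (E : finType) := Matroid {
  indep : pred {set E};
  indep0 : indep set0;
  indep_sub : forall S T : {set E}, S \subset T -> indep T -> indep S;
  indep_aug : forall S T : {set E}, indep S -> indep T -> (#|S| < #|T|)%N ->
    exists2 e : E, e \in T :\: S & indep (e |: S) }.

(* A random access machine with named arrays of naturals and named arrays of
   reals. A program is a finite term that mentions neither the input size nor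
   any real number. Naturals have no unit-cost product, and reals are only
   added, subtracted, compared, and multiplied or divided by naturals; hence t
   steps on rational oracle values amount to a number of bit operations
   polynomial in t and the sizes involved. *)
Inductive nexp : Type :=
| NConst of nat
| NGet of nat & nexp        (* array name, index *)
| NAdd of nexp & nexp
| NSub of nexp & nexp.      (* truncated *)

Inductive rexp : Type :=
| RNat of nexp
| RGet of nat & nexp
| RAdd of rexp & rexp
| RSub of rexp & rexp
| RMuln of rexp & nexp
| RDivn of rexp & nexp.     (* division by 0 yields 0 *)

Inductive bexp : Type :=
| BNle of nexp & nexp
| BRle of rexp & rexp
| BNot of bexp
| BAnd of bexp & bexp.

Inductive cmd : Type :=
| Skip
| NSet of nat & nexp & nexp     (* NSet x i v  is  x[i] := v *)
| RSet of nat & nexp & rexp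
| AskValue of nat & nexp & nat  (* AskValue x i s  is  x[i] := f (s) *)
| AskIndep of nat & nexp & nat  (* AskIndep x i s  is  x[i] := (s \in I) *)
| Seq of cmd & cmd
| If of bexp & cmd & cmd
| While of bexp & cmd.

Section Machine.
Variable R : realType.

Record state := State {
  nmem : nat -> nat -> nat;
  rmem : nat -> nat -> R }.

Definition upd (V : Type) (m : nat -> nat -> V) (x i : nat) (v : V) :=
  fun y j => if (y == x) && (j == i) then v else m y j.

Definition nset (st : state) x i v := State (upd (nmem st) x i v) (rmem st).
Definition rset (st : state) x i v := State (nmem st) (upd (rmem st) x i v).

Fixpoint neval (st : state) (a : nexp) : nat :=
  match a with
  | NConst k => k
  | NGet x i => nmem st x (neval st i)
  | NAdd a b => (neval st a + neval st b)%N
  | NSub a b => (neval st a - neval st b)%N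
  end.

Fixpoint reval (st : state) (r : rexp) : R :=
  match r with
  | RNat a => (neval st a)%:R
  | RGet x i => rmem st x (neval st i)
  | RAdd r s => reval st r + reval st s
  | RSub r s => reval st r - reval st s
  | RMuln r a => reval st r *+ neval st a
  | RDivn r a => reval st r / (neval st a)%:R
  end.

Fixpoint beval (st : state) (b : bexp) : bool :=
  match b with
  | BNle a c => (neval st a <= neval st c)%N
  | BRle r s => reval st r <= reval st s
  | BNot b => ~~ beval st b
  | BAnd b c => beval st b && beval st c
  end.

Variables (n : nat) (f : {set 'I_n} -> R) (I : pred {set 'I_n}).

(* The first n cells of an array, read as an indicator vector. *)
Definition set_at (st : state) (s : nat) : {set 'I_n} :=
  [set i : 'I_n | nmem st s i != 0%N].

(* exec c st t st' : started in st, c halts in st' after t steps. Atomic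
   commands, oracle calls and tests each take one step (expressions have a size
   fixed by the program). *)
Inductive exec : cmd -> state -> nat -> state -> Prop :=
| ExecSkip st : exec Skip st 1 st
| ExecNSet st x i a :
    exec (NSet x i a) st 1 (nset st x (neval st i) (neval st a))
| ExecRSet st x i r :
    exec (RSet x i r) st 1 (rset st x (neval st i) (reval st r))
| ExecAskValue st x i s :
    exec (AskValue x i s) st 1 (rset st x (neval st i) (f (set_at st s)))
| ExecAskIndep st x i s :
    exec (AskIndep x i s) st 1
      (nset st x (neval st i) (nat_of_bool (I (set_at st s))))
| ExecSeq c d st st1 st2 t1 t2 :
    exec c st t1 st1 -> exec d st1 t2 st2 -> exec (Seq c d) st (t1 + t2) st2
| ExecIf b c d st st1 t :
    exec (if beval st b then c else d) st t st1 -> exec (If b c d) st t.+1 st1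
| ExecWhileF b c st : ~~ beval st b -> exec (While b c) st 1 st
| ExecWhileT b c st st1 st2 t1 t2 :
    beval st b -> exec c st t1 st1 -> exec (While b c) st1 t2 st2 ->
    exec (While b c) st (t1 + t2).+1 st2.

Lemma exec_deterministic c st t1 st1 t2 st2 :
  exec c st t1 st1 -> exec c st t2 st2 -> t1 = t2 /\ st1 = st2.
Proof.
move=> H; elim: H t2 st2 => {c st t1 st1}
  [st|st x i a|st x i r|st x i s|st x i s|c d st s1 s2 t1 t2 _ IH1 _ IH2
  |b c d st s1 t _ IH|b c st nb|b c st s1 s2 t1 t2 hb _ IH1 _ IH2] t' st' H;
  inversion H as [| | | | |? ? ? s1' s2' t1' t2' E1 E2|? ? ? ? ? ? E
                 |? ? ? nb'|? ? ? s1' s2' t1' t2' hb' E1 E2]; subst => //.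
- have [? ?] := IH1 _ _ E1; subst.
  by have [? ?] := IH2 _ _ E2; subst.
- by have [? ?] := IH _ _ E; subst.
- by rewrite hb' in nb.
- by rewrite hb in nb'.
- have [? ?] := IH1 _ _ E1; subst.
  by have [? ?] := IH2 _ _ E2; subst.
Qed.

(* Array 0 of naturals holds the input size in its cell 0; all other cells are
   initially zero. *)
Definition init : state :=
  State (upd (fun _ _ => 0%N) 0 0 n) (fun _ _ => 0).

(* The output set is read from array 1 of naturals. *)
Definition outputs (A : cmd) (t : nat) (S : {set 'I_n}) : Prop :=
  exists2 st : state, exec A init t st & set_at st 1 = S.

End Machine.

(* Main.v *)
Require Import Defs.
From HB Require Import structures.
From mathcomp Require Import all_boot all_order all_algebra.
From mathcomp Require Import perm.
From mathcomp Require Import reals sequences exp.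
From mathcomp Require Import ring lra zify.

Set Implicit Arguments.
Unset Strict Implicit.
Unset Printing Implicit Defensive.

Import Order.TTheory GRing.Theory Num.Theory.

Local Open Scope ring_scope.

(** Non-oblivious local search of Buchbinder and Feldman.  The current base is
    kept as a disjoint union S_1, .., S_l, where l ~ 2/eps, and single-element
    exchanges are made as long as they noticeably increase
      Phi = sum_J alpha_|J| f(U_(j in J) S_j) + l alpha_1 L(S),
    where L is the modular function of the last marginals f(e | E - e).  Up to
    the choice of weights Phi is the same potential for the residual g = f - L,
    plus a multiple of L(S).  Summing the failed exchanges along a bijection
    between S and an optimal base O, and over the receiving part, the sum over J
    telescopes and leaves f(S) >= (1 - b) g(O) + L(O) + b f(0) with
    b = (l/(l+1))^l ~ 1/e; since L(O) + f(0) >= (1 - kappa) f(O), this is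
    (1 - b kappa) f(O).  An exchange must gain a fixed fraction 1/(n l) of the
    best independent singleton, which is at least a 1/n fraction of the optimum,
    so that O(n^2) scans suffice. *)

(** * Basis exchange *)

Section MatroidExchange.
Variables (E : finType) (M : matroid E).
Local Notation I := (indep M).

Lemma indep_extend (S T : {set E}) : I S -> I T -> (#|S| <= #|T|)%N ->
  exists D : {set E}, [/\ S \subset D, D \subset S :|: T, I D & #|D| = #|T|].
Proof.
move=> iS iT; move En: (#|T| - #|S|)%N => k.
elim: k S iS En => [|k IH] S iS h le_ST.
  exists S; rewrite subxx subsetUl iS; split=> //.
  by apply/eqP; rewrite eqn_leq le_ST -subn_eq0 h.
have lt_ST : (#|S| < #|T|)%N by rewrite -subn_gt0 h.
have [e /setDP[eT eS] ieS] := indep_aug iS iT lt_ST.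
have cS : #|e |: S| = #|S|.+1 by rewrite cardsU1 eS.
have [||D [sSD sDU iD cD]] := IH _ ieS; rewrite ?cS ?subnS ?h //.
exists D; split=> //; first exact: subset_trans (subsetUr _ _) sSD.
apply: (subset_trans sDU); rewrite -setUA subUset subxx andbT sub1set.
by rewrite inE eT orbT.
Qed.

(** [C] consists of the elements that [o] can replace in [S]: the fundamental circuit of [o],
    without [o] itself, when [o |: S] is dependent. Comparing the ranks of [C] and [O :\ o] shows
    that some element of [C] can also replace [o] in [O]. *)
Lemma symmetric_exchange (S O : {set E}) (o : E) :
  I S -> I O -> #|S| = #|O| -> o \in O -> o \notin S ->
  exists u, [/\ u \in S, u \notin O, I (o |: (S :\ u)) & I (u |: (O :\ o))].
Proof.
move=> iS iO cSO oO oS.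
have iB : I (O :\ o) by apply: indep_sub iO; apply: subsetDl.
have cB : #|O| = #|O :\ o|.+1 by rewrite (cardsD1 o O) oO.
pose C := [set u in S | I (o |: (S :\ u))].
have sCS : C \subset S by apply/subsetP=> u; rewrite inE => /andP[].
have iC : I C := indep_sub sCS iS.
have uO u : u \in S -> u \notin O :\ o -> u \notin O.
  by move=> uS; rewrite !inE; case: eqP => [uo|//]; rewrite -uo uS in oS.
case: (boolP [exists u in C, (u \notin O :\ o) && I (u |: (O :\ o))]).
  case/existsP=> u /and3P[]; rewrite inE => /andP[uS iu] uO' iu'.
  by exists u; split=> //; apply: uO.
(* Otherwise C would lie in the span of O - o, although o lies in the span of C. *)
move/existsPn=> noex.
have [CS|nCS] := eqVneq C S.
  have [|u /setDP[uS uB] iu] := indep_aug iB iS; first by rewrite cSO cB.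
  by have := noex u; rewrite CS uS uB iu.
exfalso.
have oC : o \notin C by apply: contra oS; apply: (subsetP sCS).
(* An independent [o |: C] would extend inside [o |: S] to size [#|S|], hence to [o |: (S :\ u)] for
   some [u] outside [C]; but then [u] belongs to [C]. *)
have dCo : ~~ I (o |: C).
  apply/negP=> iCo; have ltC : (#|C| < #|S|)%N.
    by apply: proper_card; rewrite properEneq nCS.
  have [|D [sD sDU iD cD]] := indep_extend iCo iS.
    by rewrite cardsU1 oC.
  have oD : o \in D by rewrite (subsetP sD) // setU11.
  have [u uS uD] : exists2 u, u \in S & u \notin D.
    apply/subsetPn; apply/negP=> sSD.
    have : (#|o |: S| <= #|D|)%N.
      by apply: subset_leq_card; rewrite subUset sub1set oD.
    by rewrite cardsU1 oS cD ltnn.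
  have uC : u \notin C by apply: contra uD => uC; rewrite (subsetP sD) // inE uC orbT.
  case/negP: uC; rewrite inE uS.
  suff <- : D = o |: (S :\ u) by [].
  apply/eqP; rewrite eqEcard cD cardsU1 (cardsD1 u S) uS !inE (negbTE oS) andbF.
  rewrite leqnn andbT.
  apply/subsetP=> x xD; have := subsetP sDU x xD; rewrite !inE.
  have -> /= : x != u by apply: contraNneq uD => <-.
  by case/orP=> [/orP[->//|/andP[->]]|->]; rewrite !orbT.
(* [D] has size [#|O| - 1] and lies in [C :|: (O :\ o)]. Augmenting it from [O] cannot add [o], so
   an independent set of size [#|O|] exists there, and augmenting [O :\ o] from that set picks an
   element of [C]. *)
have [|D [sD sDU iD cD]] := indep_extend iC iB.
  by rewrite -ltnS -cB -cSO; apply: proper_card; rewrite properEneq nCS.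
have [|e /setDP[eO eD] ieD] := indep_aug iD iO; first by rewrite cD cB.
have [eo|neo] := eqVneq e o.
  case/negP: dCo; apply: indep_sub ieD; rewrite eo; apply: setUS; exact: sD.
have [|x] := indep_aug iB ieD; first by rewrite cardsU1 eD cD.
case/setDP=> xU xB ixB.
have xC : x \in C.
  have : x \in C :|: (O :\ o).
    case/setU1P: xU => [-> | xD]; last exact: (subsetP sDU).
    by rewrite !inE neo eO orbT.
  by case/setUP=> // xB'; rewrite xB' in xB.
by have := noex x; rewrite xC xB ixB.
Qed.

(** Induction on [#|O :\: S|]: a symmetric exchange replaces [o] by [u] in [O] and keeps it
    independent. The bijection for the new set fixes [u], which now lies in both sets, so composing
    it with the transposition of [o] and [u] sends [o] to [u]. *)
Lemma exchange_bijection (S O : {set E}) : I S -> I O -> #|S| = #|O| ->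
  exists p : {perm E}, [/\ p @: O = S,
    forall o, o \in O -> I (o |: (S :\ p o)) &
    forall o, o \in O -> o \in S -> p o = o].
Proof.
move=> iS; move En: #|O :\: S| => k; elim: k O En => [|k IH] O En iO cSO.
  have sOS : O \subset S by rewrite -setD_eq0 -cards_eq0 En.
  have -> : O = S by apply/eqP; rewrite eqEcard sOS cSO leqnn.
  exists 1%g; split=> [|o oO|o _ _]; last by rewrite perm1.
    by rewrite -[RHS]imset_id; apply: eq_imset => x; rewrite perm1.
  by rewrite perm1 setD1K.
have [o /setDP[oO oS]] : exists o, o \in O :\: S.
  by apply/set0Pn; rewrite -cards_eq0 En.
have [u [uS uO iSo iOu]] := symmetric_exchange iS iO cSO oO oS.
have uo : u != o by apply: contraNneq uO => ->.
have uO' : u \notin O :\ o by apply: contra uO => /setD1P[].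
have [||p [pO pI pfix]] := IH _ _ iOu.
- rewrite -[k]/(k.+1.-1) -En (cardsD1 o (O :\: S)) !inE oO oS /=.
  apply: eq_card => x; rewrite !inE.
  by case: (eqVneq x u) => [->|_]; rewrite ?uS ?(negbTE uO) ?andbF // andbCA.
- by rewrite cardsU1 uO' cSO (cardsD1 o O) oO.
have pu : p u = u by rewrite pfix ?setU11.
have pN x : x \in O -> x != o -> ((tperm o u * p)%g x = p x).
  move=> xO xo; rewrite permM tpermD // 1?eq_sym //.
  by apply: contraNneq uO => <-.
have po : (tperm o u * p)%g o = u by rewrite permM tpermL.
have inO' x : x \in O -> x != o -> x \in u |: (O :\ o).
  by move=> xO xo; rewrite !inE xO xo orbT.
exists (tperm o u * p)%g; split=> [|x xO|x xO xS].
- rewrite -pO; apply/setP=> y; apply/imsetP/imsetP=> -[x xO ->].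
    have [->|xo] := eqVneq x o; first by exists u; rewrite ?setU11 // po.
    by exists x; rewrite ?inO' // pN.
  case/setU1P: xO => [->|/setD1P[xo xO]]; first by exists o; rewrite // po.
  by exists x => //; rewrite pN.
- by have [->|xo] := eqVneq x o; rewrite ?po // pN // pI // inO'.
- have xo : x != o by apply: contraNneq oS => <-.
  by rewrite pN // pfix // inO'.
Qed.

End MatroidExchange.

(** * Submodular functions and the weights of the potential *)

Section Submodular.
Variables (R : realType) (E : finType) (g : {set E} -> R).
Hypotheses (g_sub : submodular g) (g_mon : monotone g).
Implicit Types (S T X Y Z O : {set E}).

(** Submodularity for [a |: X] and [Y]; monotonicity bounds the value at their intersection from
    below by [g X], which also covers [a] in [Y]. *)
Lemma marginal_add (a : E) X Y :
  X \subset Y -> g (a |: Y) - g Y <= g (a |: X) - g X.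
Proof.
move=> sXY; have := g_sub (a |: X) Y; rewrite -setUA (setUidPr sXY).
have := g_mon (_ : X \subset (a |: X) :&: Y).
by rewrite subsetI subsetUr sXY => /(_ isT); lra.
Qed.

Lemma marginal_remove (a : E) X Y : X \subset Y -> (a \in Y -> a \in X) ->
  g Y - g (Y :\ a) <= g X - g (X :\ a).
Proof.
move=> sXY; have [aY /(_ isT) aX|aY _] := boolP (a \in Y).
  have := @marginal_add a _ _ (setSD [set a] sXY).
  by rewrite !setD1K.
have aX : a \notin X by apply: contra aY; apply: subsetP.
have sub1 Z : a \notin Z -> Z :\ a = Z.
  by move=> aZ; apply/setDidPl; rewrite disjoint_sym disjoints1.
by rewrite !sub1 // !subrr.
Qed.

Lemma marginal_sum_ge X O :
  g (X :|: O) - g X <= \sum_(o in O) (g (o |: X) - g X).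
Proof.
rewrite -big_enum /= -[O in X :|: O]set_enum.
elim: (enum O) => [|a s IH].
  by rewrite big_nil set_nil setU0 subrr.
rewrite big_cons set_cons setUCA.
have := @marginal_add a X (X :|: [set:: s]) (subsetUl _ _); lra.
Qed.

Lemma marginal_sum_le X Y :
  \sum_(u in Y) (g X - g (X :\ u)) <= g X - g (X :\: Y).
Proof.
rewrite -big_enum /= -[Y in X :\: Y]set_enum.
elim: (enum Y) (enum_uniq Y) => [|a s IH] /=.
  by rewrite big_nil set_nil setD0 subrr.
case/andP=> as_ us; rewrite big_cons set_cons setUC -setDDl.
have := @marginal_remove a (X :\: [set:: s]) X (subsetDl _ _).
rewrite !inE as_ => /(_ (fun aX => aX)); have := IH us; lra.
Qed.

End Submodular.

(* ((l+1)/l)^(k-1) / 'C(l-1, k-1), scaled by l^l (l-1)! to be a natural number.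
   The junk value at k = 0 only shifts the potential by a constant. *)
Definition alpha (l k : nat) : nat :=
  l.+1 ^ k.-1 * l ^ (l.+1 - k) * k.-1`! * (l - k)`!.

(** Makes the coefficients of all sets other than the empty and the full one cancel in
    [alpha_telescope]. *)
Lemma alpha_rec l k : (0 < k < l)%N ->
  (l.+1 * k * alpha l k = l * (l - k) * alpha l k.+1)%N.
Proof.
case: k => // k /= kl; rewrite /alpha /= !subSS.
rewrite -(subnK kl); move: (l - k.+2)%N => m.
have -> : (m + k.+2 - k = m.+2)%N by lia.
have -> : (m + k.+2 - k.+1 = m.+1)%N by lia.
have -> : (m + k.+2 - k.+2 = m)%N by lia.
by rewrite !factS !expnS; ring.
Qed.

(** * Telescoping identities for the weights *)

Section Telescope.
Variables (R : realType) (l : nat).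
Local Notation a k := ((alpha l k)%:R : R).

(** Collected by sets, the coefficient of [x J] is [l.+1 * #|J| * a #|J| - l * (l - #|J|) * a
    #|J|.+1], which vanishes by [alpha_rec] unless [J] is empty or full. *)
Lemma alpha_telescope (x : {set 'I_l} -> R) : (0 < l)%N ->
  \sum_(J : {set 'I_l}) a #|J| *
     (#|J|%:R * x J + l%:R * \sum_(j in J) (x J - x (J :\ j)))
  = (l.+1 * l)%:R * a l * x setT - (l * l)%:R * a 1 * x set0.
Proof.
move=> l_gt0.
(* A set [J] arises as [K :\ j] once for each [j] outside [J], always from a [K] with one more
   element. *)
have shift : \sum_(J : {set 'I_l}) a #|J| * (\sum_(j in J) x (J :\ j))
    = \sum_(J : {set 'I_l}) (l - #|J|)%:R * a #|J|.+1 * x J.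
  under eq_bigr do rewrite mulr_sumr.
  rewrite (exchange_big_dep predT) //=.
  transitivity (\sum_(j : 'I_l) \sum_(J : {set 'I_l} | j \notin J) a #|J|.+1 * x J).
    apply: eq_bigr => j _.
    rewrite (reindex_onto (fun J => j |: J) (fun J => J :\ j)) /=; last first.
      by move=> J jJ; rewrite setD1K.
    apply: eq_big => [J|J].
      rewrite setU11 /=; apply/eqP/idP => [<-|jJ]; first by rewrite setD11.
      by rewrite setU1K.
    move=> /andP[_ /eqP JE]; rewrite JE.
    have jJ : j \notin J by rewrite -JE setD11.
    by rewrite cardsU1 jJ.
  rewrite (exchange_big_dep predT) //=; apply: eq_bigr => J _.
  rewrite sumr_const -mulrA -[LHS]mulr_natl; congr (_%:R * _).
  have -> : (l - #|J|)%N = #|~: J| by have := cardsC J; rewrite card_ord; lia.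
  by apply: eq_card => j; rewrite !inE.
transitivity (\sum_(J : {set 'I_l})
   ((l.+1 * #|J|)%:R * a #|J| - (l * (l - #|J|))%:R * a #|J|.+1) * x J).
  transitivity (\sum_(J : {set 'I_l}) (l.+1 * #|J|)%:R * a #|J| * x J
     - l%:R * \sum_(J : {set 'I_l}) a #|J| * (\sum_(j in J) x (J :\ j))).
    rewrite mulr_sumr -sumrB; apply: eq_bigr => J _.
    by rewrite sumrB sumr_const -mulr_natl; ring.
  rewrite shift mulr_sumr -sumrB; apply: eq_bigr => J _; ring.
have neq : setT != set0 :> {set 'I_l}.
  by rewrite -cards_eq0 cardsT card_ord -lt0n.
rewrite (bigD1 setT) //= (bigD1 set0) //=; last by rewrite eq_sym.
rewrite big1 => [|J /andP[JT J0]].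
  by rewrite cardsT card_ord cards0 subnn subn0; ring.
have kl : (0 < #|J| < l)%N.
  rewrite lt0n cards_eq0 J0 -[X in (_ < X)%N](card_ord l) -cardsT.
  by apply: proper_card; rewrite properEneq JT subsetT.
by rewrite -!natrM alpha_rec // subrr mul0r.
Qed.

Lemma alpha_sum : (0 < l)%N ->
  \sum_(J : {set 'I_l}) a #|J| * #|J|%:R = (l.+1 * l)%:R * a l - (l * l)%:R * a 1.
Proof.
move=> l_gt0; have := alpha_telescope (fun=> 1) l_gt0; rewrite !mulr1 => <-.
by apply: eq_bigr => J _; rewrite big1 ?mulr0 ?addr0 ?mulr1 // => j _; rewrite subrr.
Qed.

(** Transpositions of the indices show that the sum is the same for every [j]; added up over all [j]
    it counts each [J] with multiplicity [#|J|], which is [alpha_sum]. *)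
Lemma alpha_sum_mem (j : 'I_l) :
  l%:R * (\sum_(J : {set 'I_l} | j \in J) a #|J|)
  = (l.+1 * l)%:R * a l - (l * l)%:R * a 1.
Proof.
rewrite -alpha_sum ?(leq_ltn_trans _ (ltn_ord j)) //.
transitivity (\sum_(i < l) \sum_(J : {set 'I_l} | i \in J) a #|J|).
  rewrite -[l in l%:R]card_ord mulr_natl -sumr_const; apply: eq_bigr => i _.
  have tI : injective (fun J : {set 'I_l} => tperm i j @: J).
    by apply: imset_inj; apply: perm_inj.
  rewrite (reindex_inj tI); apply: eq_big => J.
    by rewrite -[X in X \in _](tpermL i j) mem_imset //; apply: perm_inj.
  by rewrite card_imset //; apply: perm_inj.
rewrite (exchange_big_dep predT) //=; apply: eq_bigr => J _.
by rewrite sumr_const mulr_natr.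
Qed.

End Telescope.

(** * Local optima *)

Section Residual.
Variables (R : realType) (E : finType) (f : {set E} -> R).
Hypotheses (f_sub : submodular f) (f_mon : monotone f).
Implicit Types (S T X Y O : {set E}).

Definition last_marginal (e : E) : R := f setT - f (setT :\ e).
Local Notation L S := (\sum_(e in S) last_marginal e).

Definition residual S := f S - L S.

Lemma last_marginal_ge0 e : 0 <= last_marginal e.
Proof. by rewrite subr_ge0; apply: f_mon; apply: subsetT. Qed.

(** By submodularity the last marginal of an element is its smallest removal loss, so passing from
    [S] to [T] raises [f] at least as much as L. *)
Lemma residual_mon : monotone residual.
Proof.
move=> S T sST; rewrite /residual.
have : L (T :\: S) <= f T - f S.
  have := marginal_sum_le f_sub f_mon T (T :\: S).
  rewrite setDDr setDv set0U (setIidPr sST); apply: le_trans.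
  apply: ler_sum => e /setDP[eT _].
  by apply: marginal_remove => //; rewrite subsetT.
by rewrite [L T](big_setID S) /= (setIidPr sST); lra.
Qed.

Lemma residual_sub : submodular residual.
Proof.
move=> S T; rewrite /residual; have := f_sub S T.
rewrite [L (S :|: T)](big_setID S) /= [L T](big_setID S) /=.
by rewrite setUK setDUl setDv set0U [T :&: S]setIC; lra.
Qed.

Lemma residual0 : residual set0 = f set0.
Proof. by rewrite /residual big_set0 subr0. Qed.

(** The pair [(setT :\ e, e)] takes part in the minimum defining the curvature, so the last marginal
    of [e] is at least [(1 - curvature f) * f [set e]]. Subadditivity of [f - f set0] over the
    elements of [O] then gives the bound. *)
Lemma curvature_last_marginal O : (forall S, 0 <= f S) -> curvature f <= 1 ->
  (1 - curvature f) * f O <= L O + f set0.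
Proof.
move=> f_ge0 k_le1; set k := curvature f.
have k_ge0 : 0 <= k by have /andP[] := curvature_bounds f_mon.
have single e : (1 - k) * (f [set e] - f set0) <= last_marginal e.
  apply: (@le_trans _ _ ((1 - k) * f [set e])).
    by apply: ler_wpM2l; rewrite ?subr_ge0 // gerBl.
  (* Elements without positive value are left out of the minimum; for them the left side is at most
     0. *)
  have [fe|fe] := ltrP 0 (f [set e]); last first.
    apply: le_trans (last_marginal_ge0 e).
    by apply: mulr_ge0_le0; rewrite ?subr_ge0.
  rewrite -ler_pdivlMr //.
  rewrite /k /curvature opprB addrC subrK.
  have := bigmin_le_cond 1 (fun p : {set E} * E => (f (p.2 |: p.1) - f p.1) / f [set p.2])
    (j := (setT :\ e, e)) (P := fun p => (p.2 \notin p.1) && (0 < f [set p.2])).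
  by rewrite /= setD1K ?inE //= eqxx fe => /(_ isT).
have mO : f O - f set0 <= \sum_(e in O) (f [set e] - f set0).
  have := marginal_sum_ge f_sub f_mon set0 O; rewrite set0U.
  by under eq_bigr do rewrite setU0.
have : (1 - k) * (f O - f set0) <= L O.
  apply: le_trans (ler_wpM2l _ mO) _; first by rewrite subr_ge0.
  by rewrite mulr_sumr; apply: ler_sum => e _.
have := mulr_ge0 k_ge0 (f_ge0 set0); lra.
Qed.

End Residual.

(** * The inequality at an approximate local optimum *)

Section LocalOptimum.
Variables (R : realType) (E : finType) (f : {set E} -> R) (M : matroid E).
Variable l' : nat.
Hypotheses (f_sub : submodular f) (f_mon : monotone f).
Local Notation l := l'.+1.
Local Notation I := (indep M).
Local Notation a k := ((alpha l k)%:R : R).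
Local Notation L S := (\sum_(e in S) last_marginal f e).
Implicit Types (P : {ffun E -> option 'I_l}) (J : {set 'I_l}) (O : {set E}).

(** [P i = Some j] says that [i] lies in the part S_j, and [None] that it is outside the base; this
    encoding keeps the parts disjoint. *)
Definition part P J := [set i | if P i is Some j then j \in J else false].
Definition supp P := [set i | P i != None].
(* For u = v this moves v to part k without changing the support. *)
Definition recolor P u v k : {ffun E -> option 'I_l} :=
  [ffun i => if i == v then Some k else if i == u then None else P i].

(* The weight of the modular part is what turns this into a potential of the
   residual (potential_residual), whose modular part has the weight that makes
   L(S) and g(S) enter local_optimum with the same factor. *)
Definition potential P : R :=
  \sum_(J : {set 'I_l}) a #|J| * f (part P J)
  + (l * alpha l 1)%:R * \sum_(e in supp P) last_marginal f e.

Definition legal P u v k :=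
  [&& P u != None, (P v == None) || (u == v) & I (supp (recolor P u v k))].

Lemma part_setT P : part P setT = supp P.
Proof. by apply/setP => i; rewrite !inE; case: (P i) => [j|]; rewrite ?inE. Qed.

Lemma part_set0 P : part P set0 = set0.
Proof. by apply/setP => i; rewrite !inE; case: (P i) => [j|]; rewrite ?inE. Qed.

Lemma part_sub P J : part P J \subset supp P.
Proof. by apply/subsetP => i; rewrite !inE; case: (P i). Qed.

Lemma supp_recolor P u v k : P u != None -> (P v == None) || (u == v) ->
  supp (recolor P u v k) = v |: (supp P :\ u).
Proof.
move=> Pu Pv; apply/setP=> i; rewrite !inE ffunE.
by case: (i == v) => //=; case: (i == u).
Qed.

Lemma card_supp_recolor P u v k : P u != None -> (P v == None) || (u == v) ->
  #|supp (recolor P u v k)| = #|supp P|.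
Proof.
move=> Pu Pv; rewrite supp_recolor // cardsU1 (cardsD1 u (supp P)) !inE Pu.
by case/orP: Pv => [->|/eqP->]; rewrite ?eqxx ?andbF.
Qed.

Lemma sum_supp_recolor P u v k : P u != None -> (P v == None) || (u == v) ->
  L (supp (recolor P u v k)) - L (supp P) = last_marginal f v - last_marginal f u.
Proof.
move=> Pu Pv; rewrite supp_recolor // big_setU1 /=; last first.
  by rewrite !inE; case/orP: Pv => [->|/eqP->]; rewrite ?eqxx ?andbF.
by rewrite [L (supp P)](big_setD1 u) ?inE //=; ring.
Qed.

Lemma part_recolor P u v k J : (P v == None) || (u == v) ->
  part (recolor P u v k) J =
    if k \in J then v |: (part P J :\ u) else part P J :\ u.
Proof.
move=> Pv; have [kJ|kJ] := boolP (k \in J); apply/setP=> i; rewrite !inE ffunE.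
  by case: (i == v) => //=; case: (i == u).
case: (eqVneq i v) => [->|_]; last by case: (i == u).
rewrite (negbTE kJ); case/orP: Pv => [/eqP->|/eqP->]; first by rewrite andbF.
by rewrite eqxx.
Qed.

(** An element of part [j] is counted once for each [J] containing [j], with a total weight
    independent of [j] by [alpha_sum_mem]. Hence the modular parts of all [f (part P J)] add up to a
    multiple of L of the support. *)
Lemma potential_residual P :
  potential P = \sum_(J : {set 'I_l}) a #|J| * residual f (part P J)
    + (l.+1)%:R * a l * L (supp P).
Proof.
have w (j : 'I_l) : \sum_(J : {set 'I_l} | j \in J) a #|J|
    = l.+1%:R * a l - (l * alpha l 1)%:R.
  apply: (@mulfI _ l%:R); first by rewrite pnatr_eq0.
  by rewrite alpha_sum_mem !natrM; ring.
rewrite /residual; under [in RHS]eq_bigr do rewrite mulrBr.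
rewrite sumrB /potential.
suff -> : \sum_(J : {set 'I_l}) a #|J| * L (part P J)
    = (l.+1%:R * a l - (l * alpha l 1)%:R) * L (supp P) by ring.
under eq_bigr do rewrite mulr_sumr.
rewrite (exchange_big_dep (fun i => i \in supp P)) /=; last first.
  by move=> J i _; apply: (subsetP (part_sub P J)).
rewrite mulr_sumr; apply: eq_bigr => i; rewrite inE.
case Pi: (P i) => [j|] // _; rewrite -(w j) mulr_suml.
by apply: eq_bigl => J; rewrite inE Pi.
Qed.

Variables (P : {ffun E -> option 'I_l}) (O : {set E}) (theta : R).
Hypotheses (iP : I (supp P)) (iO : I O) (cPO : #|supp P| = #|O|).
Hypothesis P_opt : forall u v k, legal P u v k ->
  potential (recolor P u v k) <= potential P + theta.
Local Notation g := (residual f).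
Local Notation c := ((l.+1)%:R * a l).

(** By submodularity the gain of [v] can only shrink when it is measured before the removal of
    [u]. *)
Lemma recolor_gain u v k J : (P v == None) || (u == v) ->
  (k \in J)%:R * (g (v |: part P J) - g (part P J))
   - (g (part P J) - g (part P J :\ u))
  <= g (part (recolor P u v k) J) - g (part P J).
Proof.
move=> Pv; rewrite part_recolor //; case: (k \in J); last by rewrite mul0r; lra.
have := marginal_add (residual_sub f_sub) (residual_mon f_sub f_mon) v
  (subsetDl (part P J) [set u]).
by rewrite mul1r; lra.
Qed.

Lemma opt_move u v k : legal P u v k ->
  \sum_(J : {set 'I_l}) a #|J| *
    ((k \in J)%:R * (g (v |: part P J) - g (part P J))
     - (g (part P J) - g (part P J :\ u)))
  + c * (last_marginal f v - last_marginal f u) <= theta.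
Proof.
move=> lg; have := P_opt lg; case/and3P: lg => Pu Pv _.
rewrite !potential_residual supp_recolor // => h.
have eL := sum_supp_recolor k Pu Pv.
rewrite supp_recolor // in eL.
rewrite -eL; suff : \sum_(J : {set 'I_l}) a #|J| *
    ((k \in J)%:R * (g (v |: part P J) - g (part P J))
     - (g (part P J) - g (part P J :\ u))) <=
   \sum_(J : {set 'I_l}) a #|J| * g (part (recolor P u v k) J) -
   \sum_(J : {set 'I_l}) a #|J| * g (part P J) by lra.
rewrite -sumrB; apply: ler_sum => J _; rewrite -mulrBr.
by apply: ler_wpM2l => //; apply: recolor_gain.
Qed.

(** For [j] in [J], the losses from removing single elements of S_j from the union add up to at most
    the loss from removing all of S_j at once. Parts outside [J] contribute nothing. *)
Lemma part_loss J :
  \sum_(u in supp P) (g (part P J) - g (part P J :\ u))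
  <= \sum_(j in J) (g (part P J) - g (part P (J :\ j))).
Proof.
(* The default [ord0] is never reached, since [u] ranges over colored elements. *)
rewrite (partition_big (fun u => odflt ord0 (P u)) xpredT) //=.
rewrite [leRHS]big_mkcond /=; apply: ler_sum => j _.
have -> : \sum_(u | (u \in supp P) && (odflt ord0 (P u) == j))
     (g (part P J) - g (part P J :\ u))
   = \sum_(u in part P [set j]) (g (part P J) - g (part P J :\ u)).
  by apply: eq_bigl => u; rewrite !inE; case: (P u) => //= i; rewrite inE.
have [jJ|jJ] := boolP (j \in J).
  apply: (le_trans (marginal_sum_le (residual_sub f_sub) (residual_mon f_sub f_mon) _ _)).
  rewrite le_eqVlt; apply/orP; left; apply/eqP; congr (_ - g _).
  by apply/setP=> i; rewrite !inE; case: (P i) => // i'; rewrite !inE.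
rewrite big1 // => u; rewrite inE; case Pu: (P u) => [i|//]; rewrite inE => /eqP ij.
suff -> : part P J :\ u = part P J by rewrite subrr.
apply/setDidPl; rewrite disjoint_sym disjoints1 inE Pu ij; exact: jJ.
Qed.

(** [opt_move] is summed over [o] in [O], exchanged against [p o], and over all receiving parts.
    With A the coefficient of [f (supp P)] and B that of [L O + f set0], [alpha_sum] and
    [alpha_telescope] leave [(A - B) g(O) + A L(O) + B f(0) <= A f(S)] up to the slack from
    [theta]. *)
Lemma local_optimum :
  ((l.+1 * l)%:R * a l - (l * l)%:R * a 1) * f O + (l * l)%:R * a 1 * (L O + f set0)
  <= (l.+1 * l)%:R * a l * f (supp P) + (l * #|O|)%:R * theta.
Proof.
have [p [pO pI pfix]] := exchange_bijection iP iO cPO.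
have lg o k : o \in O -> legal P (p o) o k.
  move=> oO; have poS : p o \in supp P by rewrite -pO; apply: imset_f.
  (* An [o] already in the base is paired with itself, so its exchange only changes its part. *)
  have Po : (P o == None) || (p o == o).
    by case: (eqVneq (P o) None) => //= nPo; rewrite pfix // inE.
  move: (poS); rewrite inE => Ppo; rewrite /legal Ppo Po supp_recolor //=.
  exact: pI.
have : \sum_(o in O) \sum_(k < l) (\sum_(J : {set 'I_l}) a #|J| *
    ((k \in J)%:R * (g (o |: part P J) - g (part P J))
     - (g (part P J) - g (part P J :\ p o)))
  + c * (last_marginal f o - last_marginal f (p o))) <= \sum_(o in O) \sum_(k < l) theta.
  by do 2![apply: ler_sum => ? ?]; apply: opt_move; apply: lg.
rewrite [leRHS](_ : _ = (l * #|O|)%:R * theta); last first.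
  by rewrite !sumr_const card_ord -mulrnA mulr_natl.
(* For fixed [J] the incoming [o] counts for the [#|J|] receiving parts inside [J], while the
   outgoing [p o] counts for all [l]. *)
have -> : \sum_(o in O) \sum_(k < l) (\sum_(J : {set 'I_l}) a #|J| *
    ((k \in J)%:R * (g (o |: part P J) - g (part P J))
     - (g (part P J) - g (part P J :\ p o)))
  + c * (last_marginal f o - last_marginal f (p o)))
  = \sum_(J : {set 'I_l}) a #|J| *
      (#|J|%:R * \sum_(o in O) (g (o |: part P J) - g (part P J))
       - l%:R * \sum_(u in supp P) (g (part P J) - g (part P J :\ u)))
    + l%:R * c * (L O - L (supp P)).
  under eq_bigr => o oO.
    rewrite big_split /= exchange_big /= sumr_const card_ord.
    under eq_bigr => J _.
      rewrite -mulr_sumr sumrB sumr_const card_ord -mulr_suml.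
      have -> : \sum_(i < l) (i \in J)%:R = #|J|%:R :> R.
        by rewrite -sum1_card natr_sum [RHS]big_mkcond; apply: eq_bigr => i _; case: (i \in J).
      over.
    over.
  rewrite big_split /= exchange_big /=; congr (_ + _).
    apply: eq_bigr => J _; rewrite -mulr_sumr sumrB -mulr_sumr.
    congr (_ * (_ - _)).
    rewrite -pO big_imset /=; last by move=> x y _ _; apply: perm_inj.
    by rewrite mulr_sumr; apply: eq_bigr => o _; rewrite mulr_natl.
  rewrite sumrMnl -mulr_sumr sumrB -[LHS]mulr_natl mulrA; congr (_ * (_ - _)).
  by rewrite -pO big_imset //= => x y _ _; apply: perm_inj.
set TH := _ * theta => H.
have g_mon := residual_mon f_sub f_mon.
have g_sub := residual_sub f_sub.
have : \sum_(J : {set 'I_l}) a #|J| * (#|J|%:R * (g O - g (part P J))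
       - l%:R * \sum_(j in J) (g (part P J) - g (part P (J :\ j))))
    + l%:R * c * (L O - L (supp P)) <= TH.
  apply: le_trans H; rewrite lerD2r; apply: ler_sum => J _.
  apply: ler_wpM2l => //; apply: lerB; apply: ler_wpM2l => //; last exact: part_loss.
  apply: le_trans (marginal_sum_ge g_sub g_mon _ _); rewrite lerD2r.
  by apply: g_mon; apply: subsetUr.
have -> : \sum_(J : {set 'I_l}) a #|J| * (#|J|%:R * (g O - g (part P J))
       - l%:R * \sum_(j in J) (g (part P J) - g (part P (J :\ j))))
  = (\sum_(J : {set 'I_l}) a #|J| * #|J|%:R) * g O
    - \sum_(J : {set 'I_l}) a #|J| * (#|J|%:R * g (part P J)
        + l%:R * \sum_(j in J) (g (part P J) - g (part P (J :\ j)))).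
  by rewrite mulr_suml -sumrB; apply: eq_bigr => J _; ring.
rewrite alpha_sum // (alpha_telescope (fun J => g (part P J))) //.
rewrite part_setT part_set0 residual0 /residual !natrM.
set A := a l; set B := a 1; set lS := l.+1%:R; set lR := l%:R.
nra.
Qed.

End LocalOptimum.

(** The quotient of [(l * l) * alpha l 1] by [(l.+1 * l) * alpha l l] is [(l/(l+1))^l]. The power
    with exponent [l+1] is at most 1/e, and the missing factor [1 + 1/l] adds at most [1/l]. *)
Lemma inv_expR_approx (R : realType) (l : nat) : (0 < l)%N ->
  (l * l)%:R * (alpha l 1)%:R
    <= ((expR 1)^-1 + l%:R^-1) * ((l.+1 * l)%:R * (alpha l l)%:R) :> R.
Proof.
move=> l0; pose e : R := (expR 1)^-1.
have lR : (0 : R) < l%:R by rewrite ltr0n.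
have l1R : (0 : R) < l.+1%:R by rewrite ltr0n.
have pow : (l%:R / l.+1%:R) ^+ l.+1 <= e.
  have h : l%:R / l.+1%:R <= expR (- l.+1%:R^-1) :> R.
    apply: le_trans (expR_ge1Dx _); rewrite ler_pdivrMr // mulrDl mulNr.
    by rewrite mulVf ?gt_eqF // mul1r -natr1 addrK.
  have -> : e = expR (- l.+1%:R^-1) ^+ l.+1.
    by rewrite -expRM_natl mulrN mulfV ?gt_eqF // expRN.
  by apply: lerXn2r => //; rewrite nnegrE ?expR_ge0 // divr_ge0 // ltW.
have e1 : e <= 1.
  by rewrite invf_le1 ?expR_gt0 //; apply: le_trans (expR_ge1Dx 1); lra.
rewrite expr_div_n ler_pdivrMr ?exprn_gt0 // in pow.
rewrite [l%:R ^+ l.+1]exprS [l.+1%:R ^+ l.+1]exprS in pow.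
have key : l%:R ^+ l <= (e + l%:R^-1) * l.+1%:R ^+ l.
  rewrite -(ler_pM2l lR); apply: (le_trans pow).
  rewrite !mulrA ler_wpM2r ?exprn_ge0 // [l%:R * (e + _)]mulrDr mulfV ?gt_eqF //.
  by rewrite -natr1 mulrDr mulr1 [e * _]mulrC lerD2l.
have := ler_wpM2r (ler0n R (l * l * l.-1`!)) key.
rewrite /alpha subSnn subnn !subn1 /= expn0 expn1 -/e.
have -> : l.+1%:R ^+ l = l.+1%:R * l.+1%:R ^+ l.-1 :> R by rewrite -exprS prednK.
rewrite ?fact0 !natrM !natrX. lra.
Qed.

(** * Approximation guarantee of stable colorings *)

Section Guarantee.
Variables (R : realType) (E : finType) (f : {set E} -> R) (M : matroid E).
Variable l' : nat.
Hypotheses (f_sub : submodular f) (f_mon : monotone f).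
Hypothesis f_ge0 : forall S, 0 <= f S.
Local Notation l := l'.+1.
Local Notation I := (indep M).
Local Notation n := #|E|.
Implicit Types (P Q : {ffun E -> option 'I_l}) (J : {set 'I_l}) (O : {set E}).

(** The scale of the acceptance threshold: at most the optimum, and at least a 1/n fraction of the
    value of every nonempty independent set. The default 0 lies below all values of [f]. *)
Definition max_single : R := \big[Num.max/0]_(e | I [set e]) f [set e].
Local Notation m := max_single.

(** Clears the denominator of the threshold [m / (n * l)], in the form that the program tests. *)
Definition scaled_gain P Q : R := (potential f Q - potential f P) *+ n *+ l.

Definition improving P u v k :=
  legal M P u v k && (m <= scaled_gain P (recolor P u v k)).

Definition stable P := forall u v k, ~~ improving P u v k.

Definition base_coloring P :=
  I (supp P) /\ forall T, I T -> (#|T| <= #|supp P|)%N.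

(** The total weight in the potential. It depends on [l] only, so the program may contain it as a
    constant. *)
Definition weight_bound : nat := \sum_(J : {set 'I_l}) alpha l #|J| + l * alpha l 1.

Lemma max_single_ge0 : 0 <= m.
Proof. exact: bigmax_ge_id. Qed.

Lemma max_single_le O : I O -> (forall T, I T -> f T <= f O) -> m <= f O.
Proof. by move=> iO maxO; apply: bigmax_le => // e ie; apply: maxO. Qed.

(** Subadditivity of [f - f set0]; the possibly positive [f set0] is absorbed by one element [e0] of
    [S]. *)
Lemma indep_le_max_single S : I S -> S != set0 -> f S <= m *+ n.
Proof.
move=> iS /set0Pn[e0 e0S].
have le_m e : e \in S -> f [set e] <= m.
  by move=> eS; apply: le_bigmax_cond; apply: indep_sub iS; rewrite sub1set.
have : f S <= f set0 + \sum_(e in S) (f [set e] - f set0).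
  have := marginal_sum_ge f_sub f_mon set0 S; rewrite set0U.
  by under eq_bigr do rewrite setU0; lra.
move/le_trans; apply; rewrite (bigD1 e0) //= addrA [f set0 + _]addrC subrK.
apply: (@le_trans _ _ (\sum_(e in S) f [set e])).
  rewrite [leRHS](bigD1 e0) //= lerD2l; apply: ler_sum => e _.
  by rewrite gerBl.
apply: (@le_trans _ _ (\sum_(e in S) m)); first exact: ler_sum.
rewrite sumr_const -[leLHS]mulr_natl -[leRHS]mulr_natl ler_wpM2r ?max_single_ge0 //.
by rewrite ler_nat max_card.
Qed.

Lemma potential_ge0 P : 0 <= potential f P.
Proof.
apply: addr_ge0; first by apply: sumr_ge0 => J _; apply: mulr_ge0.
by apply: mulr_ge0 => //; apply: sumr_ge0 => e _; apply: last_marginal_ge0.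
Qed.

Lemma potential_le P : I (supp P) -> supp P != set0 ->
  potential f P <= m *+ n *+ weight_bound.
Proof.
move=> iP nP; have fP := indep_le_max_single iP nP.
have LP : \sum_(e in supp P) last_marginal f e <= m *+ n.
  apply: le_trans fP; have : 0 <= residual f (supp P); last by rewrite subr_ge0.
  apply: (@le_trans _ _ (residual f set0)); first by rewrite residual0.
  exact: (residual_mon f_sub f_mon (sub0set _)).
rewrite mulrnDr -[m *+ n *+ (_ * _)]mulr_natl; apply: lerD; last exact: ler_wpM2l.
rewrite -mulr_natl natr_sum mulr_suml; apply: ler_sum => J _.
by apply: ler_wpM2l => //; apply: le_trans fP; apply: f_mon; apply: part_sub.
Qed.

(** One [1/l] of the loss comes from [inv_expR_approx], the other from the slack: with
    [theta = m / (n * l)] the exchanges lose at most [f O] in total, which is small against the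
    factor A of [f (supp P)]. *)
Lemma stable_guarantee P : base_coloring P -> stable P -> curvature f <= 1 ->
  f (supp P) >= (1 - curvature f / expR 1 - 2%:R / l%:R)
                   * \big[Num.max/f set0]_(T : {set E} | I T) f T.
Proof.
case=> iP maxP stP k_le1; set k := curvature f.
have k_ge0 : 0 <= k by have /andP[] := curvature_bounds f_mon.
have [O [iO cO maxO]] : exists O, [/\ I O, #|supp P| = #|O| & forall T, I T -> f T <= f O].
  have [T iT maxT] : exists2 T, I T & forall T', I T' -> f T' <= f T.
    exists [arg max_(T > set0 | I T) f T]%O; case: arg_maxP => //; exact: indep0.
  (* By monotonicity an optimum stays optimal when extended to the size of the base, as the
     bijection requires. *)
  have [O [sTO _ iO cO]] := indep_extend iT iP (maxP _ iT).
  exists O; split=> // T' iT'; apply: le_trans (f_mon sTO); exact: maxT.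
have OPTE : \big[Num.max/f set0]_(T : {set E} | I T) f T = f O.
  apply/le_anti/andP; split; last exact: le_bigmax_cond.
  by apply: bigmax_le => //; apply: f_mon; apply: sub0set.
rewrite {}OPTE;
pose theta : R := m / (n * l)%:R.
have Popt u v j : legal M P u v j ->
    potential f (recolor P u v j) <= potential f P + theta.
  move=> lg; have := stP u v j; rewrite /improving lg /= -ltNge /scaled_gain.
  have n0 : (0 < n)%N by apply/card_gt0P; exists u.
  rewrite -mulrnA -mulr_natr -ltr_pdivlMr ?ltr0n ?muln_gt0 ?n0 //.
  by rewrite -/theta; lra.
have H := local_optimum f_sub f_mon iP iO cO Popt.
have thm : (l * #|O|)%:R * theta <= f O.
  apply: le_trans (max_single_le iO maxO); rewrite /theta.
  have [n0|n0] := posnP n; first by rewrite n0 mul0n invr0 !mulr0 max_single_ge0.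
  rewrite mulrA ler_pdivrMr ?ltr0n ?muln_gt0 ?n0 // mulrC ler_wpM2l ?max_single_ge0 //.
  by rewrite ler_nat mulnC leq_mul2r max_card orbT.
have BA := @inv_expR_approx R l isT.
have kap := curvature_last_marginal f_sub f_mon O f_ge0 k_le1.
(* After division by A the slack [f O] becomes at most [f O / l]. *)
have A1 : l%:R <= (l.+1 * l)%:R * (alpha l l)%:R :> R.
  rewrite -natrM ler_nat -mulnA mulnCA -[X in (X <= _)%N]muln1 leq_mul2l /=.
  by rewrite muln_gt0 /alpha !muln_gt0 !expn_gt0 !fact_gt0.
set A := (l.+1 * l)%:R * _ in H BA A1; set B := (l * l)%:R * _ in H BA.
set X := \sum_(e in O) _ in H kap.
have l0 : (0 : R) < l%:R by rewrite ltr0n.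
have A0 : 0 < A by apply: lt_le_trans A1.
have B0 : 0 <= B by rewrite mulr_ge0.
rewrite -(ler_pM2l A0).
have h1 := ler_wpM2l B0 kap.
have h2 : B * (k * f O) <= ((expR 1)^-1 + l%:R^-1) * A * (k * f O).
  by apply: ler_wpM2r => //; apply: mulr_ge0.
have h3 : f O <= l%:R^-1 * A * f O.
  by rewrite ler_peMl // ler_pdivlMl // mulr1.
have h4 : l%:R^-1 * A * (k * f O) <= l%:R^-1 * A * f O.
  apply: ler_wpM2l; first by apply: mulr_ge0; [rewrite invr_ge0|]; apply: ltW.
  by rewrite ler_piMl.
move: H h1 h2 h3 h4 thm; rewrite -/k.
set e := (expR 1)^-1; set li := l%:R^-1; nra.
Qed.

End Guarantee.

(** * Programs with bounded loops *)

(* PFor x p runs p with the counter nmem x 0 going through 0, .., n - 1. *)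
Inductive prog : Type :=
| Atom of cmd
| PSeq of prog & prog
| PIf of bexp & prog & prog
| PFor of nat & prog.

Definition cell0 x : nexp := NGet x (NConst 0).

Fixpoint code (p : prog) : cmd :=
  match p with
  | Atom c => c
  | PSeq p q => Seq (code p) (code q)
  | PIf b p q => If b (code p) (code q)
  | PFor x p => Seq (NSet x (NConst 0) (NConst 0))
      (While (BNot (BNle (cell0 0) (cell0 x)))
        (Seq (code p) (NSet x (NConst 0) (NAdd (cell0 x) (NConst 1)))))
  end.

(** An upper bound in n: both branches of a test are counted, each pass of a loop pays 2 for test
    and increment, and the loop pays 2 for the reset and the failing test. *)
Fixpoint cost (p : prog) : {poly nat} :=
  match p with
  | Atom _ => 1%:P
  | PSeq p q => cost p + cost q
  | PIf _ p q => 1%:P + cost p + cost q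
  | PFor _ p => 'X * (cost p + 2%N%:P) + 2%N%:P
  end.

Fixpoint nwrites (p : prog) (x : nat) : bool :=
  match p with
  | Atom (NSet y _ _) | Atom (AskIndep y _ _) => x == y
  | Atom _ => false
  | PSeq p q | PIf _ p q => nwrites p x || nwrites q x
  | PFor y p => (x == y) || nwrites p x
  end.

Fixpoint rwrites (p : prog) (x : nat) : bool :=
  match p with
  | Atom (RSet y _ _) | Atom (AskValue y _ _) => x == y
  | Atom _ => false
  | PSeq p q | PIf _ p q => rwrites p x || rwrites q x
  | PFor y p => rwrites p x
  end.

Definition atomic (c : cmd) : bool :=
  match c with Seq _ _ | If _ _ _ | While _ _ => false | _ => true end.

(** A loop body may write neither its counter nor array 0, which holds n, so that the loop makes
    exactly n passes. *)
Fixpoint well_formed (p : prog) : bool :=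
  match p with
  | Atom c => atomic c
  | PSeq p q | PIf _ p q => well_formed p && well_formed q
  | PFor x p => [&& x != 0%N, ~~ nwrites p x, ~~ nwrites p 0 & well_formed p]
  end.

Definition pseq : seq prog -> prog := foldr PSeq (Atom Skip).

Lemma nwrites_pseq (A : Type) (F : A -> prog) s x :
  (forall a, nwrites (F a) x = false) -> nwrites (pseq (map F s)) x = false.
Proof. by move=> H; elim: s => //= a s ->; rewrite H. Qed.

Lemma rwrites_pseq (A : Type) (F : A -> prog) s x :
  (forall a, rwrites (F a) x = false) -> rwrites (pseq (map F s)) x = false.
Proof. by move=> H; elim: s => //= a s ->; rewrite H. Qed.

Lemma well_formed_pseq (A : Type) (F : A -> prog) s :
  (forall a, well_formed (F a)) -> well_formed (pseq (map F s)).
Proof. by move=> H; elim: s => //= a s ->; rewrite H. Qed.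

(** * Functional semantics, loop rules and running time *)

Section Denotation.
Variables (R : realType) (n : nat) (f : {set 'I_n} -> R) (I : pred {set 'I_n}).
Local Notation state := (state R).
Implicit Types (st s : state) (p q : prog).

Definition den_atom (c : cmd) st : state :=
  match c with
  | NSet x i a => nset st x (neval st i) (neval st a)
  | RSet x i r => rset st x (neval st i) (reval st r)
  | AskValue x i y => rset st x (neval st i) (f (set_at n st y))
  | AskIndep x i y => nset st x (neval st i) (nat_of_bool (I (set_at n st y)))
  | _ => st
  end.

Fixpoint den p st : state :=
  match p with
  | Atom c => den_atom c st
  | PSeq p q => den q (den p st)
  | PIf b p q => if beval st b then den p st else den q st
  | PFor x p =>
      iter n (fun s => nset (den p s) x 0 (nmem (den p s) x 0 + 1)) (nset st x 0 0)
  end.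

Lemma nmem_den p st x : nwrites p x = false -> nmem (den p st) x =1 nmem st x.
Proof.
elim: p st => [c|p IHp q IHq|b p IHp q IHq|y p IHp] st /=.
- by case: c => //= y i a h j; rewrite /upd h.
- by move=> /negbT; rewrite negb_or => /andP[/negbTE hp /negbTE hq] j; rewrite IHq ?IHp.
- by move=> /negbT; rewrite negb_or => /andP[/negbTE hp /negbTE hq]; case: ifP => _; auto.
move=> /negbT; rewrite negb_or => /andP[/negbTE hy /negbTE hp] j.
have -> : nmem st x j = nmem (nset st y 0 0) x j by rewrite /= /upd hy.
by elim: n (nset _ _ _ _) => //= m IH s; rewrite /upd hy /= IHp.
Qed.

Lemma rmem_den p st x : rwrites p x = false -> rmem (den p st) x =1 rmem st x.
Proof.
elim: p st => [c|p IHp q IHq|b p IHp q IHq|y p IHp] st /=.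
- by case: c => //= y i a h j; rewrite /upd h.
- by move=> /negbT; rewrite negb_or => /andP[/negbTE hp /negbTE hq] j; rewrite IHq ?IHp.
- by move=> /negbT; rewrite negb_or => /andP[/negbTE hp /negbTE hq]; case: ifP => _; auto.
move=> hp j.
have -> : rmem st x j = rmem (nset st y 0 0) x j by [].
by elim: n (nset _ _ _ _) => //= m IH s; rewrite IHp.
Qed.

(** The invariant rule for loops, indexed by the number of completed passes. *)
Lemma den_for (Inv : nat -> state -> Prop) x p st :
  nwrites p x = false -> Inv 0 (nset st x 0 0) ->
  (forall (i : 'I_n) s, nmem s x 0 = i -> Inv i s -> Inv i.+1 (nset (den p s) x 0 i.+1)) ->
  Inv n (den (PFor x p) st).
Proof.
move=> hx h0 hS /=.
set F := fun s => _.
suff : forall m, (m <= n)%N ->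
    Inv m (iter m F (nset st x 0 0)) /\ nmem (iter m F (nset st x 0 0)) x 0 = m.
  by move=> /(_ n (leqnn n))[].
elim=> [|m IH] mn; first by rewrite /= /upd !eqxx.
have [IHi IHm] := IH (ltnW mn); rewrite iterS; move: (iter m F _) IHi IHm => s hi hm.
rewrite /F nmem_den // hm addn1; split; last by rewrite /= /upd !eqxx.
exact: (hS (Ordinal mn)).
Qed.

Lemma den_pseq (A : Type) (F : A -> prog) (Inv : seq A -> state -> Prop) r st :
  Inv [::] st ->
  (forall r1 a s, Inv r1 s -> Inv (rcons r1 a) (den (F a) s)) ->
  Inv r (den (pseq (map F r)) st).
Proof.
move=> h0 hS.
suff H : forall r2 r1 s, Inv r1 s -> Inv (r1 ++ r2) (den (pseq (map F r2)) s).
  exact: (H r [::]).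
elim=> [|a r2 IH] r1 s h; first by rewrite cats0.
by rewrite -cat_rcons; apply: IH; apply: hS.
Qed.

(** Termination and the time bound follow by structural induction, so the algorithm itself can be
    verified through [den] alone. *)
Lemma exec_den p st : well_formed p -> nwrites p 0 = false -> nmem st 0 0 = n ->
  exists2 t, exec f I (code p) st t (den p st) & (t <= (cost p).[n])%N.
Proof.
elim: p st => [c|p IHp q IHq|b p IHp q IHq|x p IHp] st /=.
- move=> ac _ _; exists 1%N; last by rewrite hornerC.
  by case: c ac => //= *; constructor.
- move=> /andP[wp wq] /negbT; rewrite negb_or => /andP[/negbTE hp /negbTE hq] st0.
  have [t1 e1 l1] := IHp _ wp hp st0.
  have [|t2 e2 l2] := IHq (den p st) wq hq; first by rewrite nmem_den.
  exists (t1 + t2)%N; first exact: ExecSeq e1 e2.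
  by rewrite hornerD leq_add.
- move=> /andP[wp wq] /negbT; rewrite negb_or => /andP[/negbTE hp /negbTE hq] st0.
  have [t1 e1 l1] := IHp _ wp hp st0; have [t2 e2 l2] := IHq _ wq hq st0.
  rewrite !hornerD hornerC.
  have -> : (1%N + (cost p).[n] + (cost q).[n])%R = (1 + (cost p).[n] + (cost q).[n])%N by [].
  have [bt|bf] := boolP (beval st b).
    by exists t1.+1; [constructor; rewrite bt | lia].
  by exists t2.+1; [constructor; rewrite (negbTE bf) | lia].
case/and4P=> x0 wx _ wp; rewrite (eq_sym 0%N) (negbTE x0) /= => w0 st0.
move/negbTE in wx.
set F := fun s => _; set W := While _ _.
have loop : forall m s, (m <= n)%N -> nmem s 0 0 = n -> nmem s x 0 = (n - m)%N ->
    exists2 t, exec f I W s t (iter m F s) & (t <= m * ((cost p).[n] + 2) + 1)%N.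
  elim=> [|m IH] s mn s0 sx.
    by exists 1%N => //; apply: ExecWhileF; rewrite /= s0 sx subn0 leqnn.
  have [t1 e1 l1] := IHp s wp w0 s0.
  have sx' : nmem (den p s) x 0 = (n - m.+1)%N by rewrite nmem_den.
  have [|||t2 e2 l2] := IH (F s).
  - exact: ltnW.
  - by rewrite /F /= /upd (eq_sym 0%N) (negbTE x0) /= nmem_den.
  - by rewrite /F /= /upd !eqxx /= sx'; lia.
  exists (t1 + 1 + t2).+1; last by rewrite mulSn; move: l1 l2; set z := _.[_]; lia.
  rewrite iterSr; apply: ExecWhileT e2; first by rewrite /= s0 sx -ltnNge; lia.
  by apply: ExecSeq e1 _; apply: ExecNSet.
have [||t e l] := loop n (nset st x 0 0) (leqnn n).
- by rewrite /= /upd (eq_sym 0%N) (negbTE x0).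
- by rewrite /= /upd !eqxx subnn.
exists (1 + t)%N; first by apply: ExecSeq e; apply: ExecNSet.
rewrite !(hornerD, hornerM, hornerC, hornerX); move: l; set z := _.[_].
rewrite -[(_ + _)%R]/(_ + _)%N; lia.
Qed.

End Denotation.

(** * The algorithm *)

(* Arrays of naturals: 1 the part of each element, plus one, or 0 outside the
   current base; 2 the indicator of J on these codes; 3, 11, 12 query sets;
   4 the last independence answer; 5 .. 9 loop counters, with u in 6 and v in 7;
   10 the saved parts of u and v.  Arrays of reals: 0 the potential and query
   answers; 1 the last marginals; 2 the best independent singleton; 3 the
   potential before a move. *)
Section Programs.
Variable l' : nat.
Local Notation l := l'.+1.
Implicit Types (J : {set 'I_l}) (k : 'I_l).

(** Membership of an element in the union over [J] is a double lookup, from element to code to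
    indicator. Code 0 has indicator 0, which leaves out the elements outside the base. *)
Definition value_part J : prog :=
  PSeq (Atom (NSet 2 (NConst 0) (NConst 0)))
 (PSeq (pseq [seq Atom (NSet 2 (NConst (val j).+1) (NConst (j \in J))) | j <- enum 'I_l])
 (PSeq (PFor 5 (Atom (NSet 3 (cell0 5) (NGet 2 (NGet 1 (cell0 5))))))
 (PSeq (Atom (AskValue 0 (NConst 1) 3))
       (Atom (RSet 0 (NConst 0) (RAdd (RGet 0 (NConst 0))
          (RMuln (RGet 0 (NConst 1)) (NConst (alpha l #|J|))))))))).

Definition parts_value : prog :=
  PSeq (Atom (RSet 0 (NConst 0) (RNat (NConst 0))))
       (pseq [seq value_part J | J <- enum {set 'I_l}]).

Definition at_u : nexp := cell0 6.
Definition at_v : nexp := cell0 7.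

Definition nzero (a : nexp) : bexp := BNle a (NConst 0).

Definition guard : bexp :=
  BAnd (BNot (nzero (NGet 1 at_u)))
       (BNot (BAnd (BNot (nzero (NGet 1 at_v)))
                   (BNot (BAnd (BNle at_u at_v) (BNle at_v at_u))))).

(** An exchange changes L of the base by the last marginals of [v] and [u], so adding these to the
    new and the old sum over [J] yields the correct difference of potentials. *)
Definition weighted_value (x : nat) (a : nexp) : rexp :=
  RAdd (RGet x (NConst 0)) (RMuln (RGet 1 a) (NConst (l * alpha l 1))).

Definition accept : bexp :=
  BAnd (BNot (nzero (cell0 4)))
    (BRle (RGet 2 (NConst 0))
      (RMuln (RMuln (RSub (weighted_value 0 at_v) (weighted_value 3 at_u)) (cell0 0))
             (NConst l))).

(** Clearing [u] before coloring [v] makes the case [u = v] a change of part. *)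
Definition make_move k : prog :=
  PSeq (Atom (RSet 3 (NConst 0) (RGet 0 (NConst 0))))
 (PSeq (Atom (NSet 10 (NConst 0) (NGet 1 at_u)))
 (PSeq (Atom (NSet 10 (NConst 1) (NGet 1 at_v)))
 (PSeq (Atom (NSet 1 at_u (NConst 0)))
       (Atom (NSet 1 at_v (NConst (val k).+1)))))).

Definition move_and_evaluate k : prog :=
  PSeq parts_value (PSeq (make_move k) (PSeq parts_value (Atom (AskIndep 4 (NConst 0) 1)))).

Definition undo_move : prog :=
  PSeq (Atom (NSet 1 at_v (NGet 10 (NConst 1))))
       (Atom (NSet 1 at_u (NGet 10 (NConst 0)))).

Definition try_move k : prog :=
  PIf guard (PSeq (move_and_evaluate k) (PIf accept (Atom Skip) undo_move)) (Atom Skip).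

Definition scan : prog := PFor 6 (PFor 7 (pseq [seq try_move k | k <- enum 'I_l])).

Definition local_search (r : nat) : prog :=
  PFor 8 (PFor 9 (pseq [seq scan | _ <- iota 0 r])).

(** The greedy base, placed entirely in part 0, whose code is 1. *)
Definition init_base : prog :=
  PFor 5 (PSeq (Atom (NSet 1 (cell0 5) (NConst 1)))
         (PSeq (Atom (AskIndep 4 (NConst 0) 1))
         (PIf (nzero (cell0 4)) (Atom (NSet 1 (cell0 5) (NConst 0))) (Atom Skip)))).

Definition init_marginals : prog :=
  PSeq (PFor 5 (Atom (NSet 12 (cell0 5) (NConst 1))))
 (PSeq (Atom (AskValue 0 (NConst 1) 12))
 (PFor 5 (PSeq (Atom (NSet 12 (cell0 5) (NConst 0)))
         (PSeq (Atom (AskValue 0 (NConst 2) 12))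
         (PSeq (Atom (RSet 1 (cell0 5) (RSub (RGet 0 (NConst 1)) (RGet 0 (NConst 2)))))
               (Atom (NSet 12 (cell0 5) (NConst 1)))))))).

Definition init_single : prog :=
  PFor 5 (PSeq (Atom (NSet 11 (cell0 5) (NConst 1)))
         (PSeq (Atom (AskIndep 4 (NConst 0) 11))
         (PSeq (Atom (AskValue 0 (NConst 1) 11))
         (PSeq (PIf (BAnd (BNot (nzero (cell0 4)))
                          (BNot (BRle (RGet 0 (NConst 1)) (RGet 2 (NConst 0)))))
                  (Atom (RSet 2 (NConst 0) (RGet 0 (NConst 1)))) (Atom Skip))
               (Atom (NSet 11 (cell0 5) (NConst 0))))))).

Definition main_prog (r : nat) : prog :=
  PSeq init_base (PSeq init_marginals (PSeq init_single (local_search r))).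

Lemma nwrites_parts_value x : x \notin [:: 2; 3; 5] -> nwrites parts_value x = false.
Proof.
rewrite !inE !negb_or => /and3P[/negbTE h2 /negbTE h3 /negbTE h5].
rewrite /parts_value /=; apply: nwrites_pseq => J /=; rewrite h2 h3 h5 /= !orbF.
by apply: nwrites_pseq => j /=.
Qed.

Lemma rwrites_parts_value x : x != 0%N -> rwrites parts_value x = false.
Proof.
move=> /negbTE x0; rewrite /parts_value /= x0; apply: rwrites_pseq => J /=; rewrite x0 /= !orbF.
by apply: rwrites_pseq => j /=.
Qed.

Lemma well_formed_parts_value : well_formed parts_value.
Proof.
rewrite /parts_value /=; apply: well_formed_pseq => J /=; rewrite !andbT.
by apply: well_formed_pseq.
Qed.

Opaque parts_value.

Lemma nwrites_try_move k x :
  x \notin [:: 1; 2; 3; 4; 5; 10] -> nwrites (try_move k) x = false.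
Proof.
rewrite !inE !negb_or => /and5P[/negbTE h1 h2 h3 /negbTE h4 /andP[h5 /negbTE h10]].
by rewrite /= h1 h4 h10 !nwrites_parts_value // !inE !negb_or h2 h3 h5.
Qed.

Lemma nwrites_scan x :
  x \notin [:: 1; 2; 3; 4; 5; 6; 7; 10] -> nwrites scan x = false.
Proof.
rewrite !inE !negb_or => h; rewrite /scan /=.
have /and5P[h1 h2 h3 h4 /and4P[h5 /negbTE h6 /negbTE h7 h10]] := h; rewrite h6 h7 /=.
by apply: nwrites_pseq => k; apply: nwrites_try_move; rewrite !inE !negb_or h1 h2 h3 h4 h5.
Qed.

Lemma well_formed_main r :
  well_formed (main_prog r) /\ nwrites (main_prog r) 0 = false.
Proof.
have wt k : well_formed (try_move k) by rewrite /= !well_formed_parts_value.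
have nt x : x \notin [:: 1; 2; 3; 4; 5; 10] ->
    nwrites (pseq [seq try_move k | k <- enum 'I_l]) x = false.
  by move=> h; apply: nwrites_pseq => k; apply: nwrites_try_move.
have ns x : x \notin [:: 1; 2; 3; 4; 5; 6; 7; 10] ->
    nwrites (pseq [seq scan | _ <- iota 0 r]) x = false.
  by move=> h; apply: nwrites_pseq => _; apply: nwrites_scan.
split; last by rewrite /main_prog /local_search /= ns.
rewrite /main_prog /local_search /= !ns //=; apply: well_formed_pseq => _.
by rewrite /scan /= !nt //=; apply: well_formed_pseq.
Qed.

End Programs.

(** * Correctness *)

Section Correctness.
Variables (R : realType) (n l' : nat) (f : {set 'I_n} -> R) (M : matroid 'I_n).
Local Notation l := l'.+1.
Local Notation state := (state R).
Local Notation den := (den f (indep M)).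
Local Notation m := (max_single f M).
Implicit Types (P Q : {ffun 'I_n -> option 'I_l}) (J : {set 'I_l}) (k : 'I_l) (st s : state).

Definition enc (o : option 'I_l) : nat := if o is Some j then j.+1 else 0%N.

Definition stores P st := forall i : 'I_n, nmem st 1 i = enc (P i).

Lemma den_value_part P J st : stores P st ->
  rmem (den (value_part J) st) 0 0 = rmem st 0 0 + f (part P J) *+ alpha l #|J|.
Proof.
move=> hP; rewrite /value_part /=.
set s0 := nset st 2 0 0.
set s1 := den _ s0.
have t1 o : nmem s1 2 (enc o) = nat_of_bool (if o is Some j then j \in J else false).
  have [t10 t1S] : nmem s1 2 0 = 0%N /\
      forall j : 'I_l, j \in enum 'I_l -> nmem s1 2 j.+1 = (j \in J).
    apply: (den_pseq (Inv := fun r s => nmem s 2 0 = 0%N /\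
      forall j : 'I_l, j \in r -> nmem s 2 j.+1 = (j \in J))); first by split.
    move=> r j s [h0 hS]; split=> //= i; rewrite mem_rcons inE /upd /= eqSS.
    have [->|nij] := eqVneq i j; first by rewrite eqxx.
    by move: (nij); rewrite -val_eqE /= => /negbTE -> /= ir; apply: hS.
  by case: o => [j|//]; rewrite t1S ?mem_enum.
have P1 : stores P s1.
  by move=> i; rewrite nmem_den; [apply: hP | apply: nwrites_pseq].
have r1 : rmem s1 0 0 = rmem st 0 0.
  by rewrite rmem_den //; apply: rwrites_pseq.
set s2 := iter _ _ _.
have [e2 r2] : (forall i : 'I_n, (i < n)%N -> nmem s2 3 i = (i \in part P J)) /\
     rmem s2 0 0 = rmem st 0 0.
  have [] : (forall i : 'I_n, (i < n)%N -> nmem s2 3 i = (i \in part P J)) /\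
     [/\ rmem s2 0 0 = rmem st 0 0, stores P s2 &
         forall o, nmem s2 2 (enc o) = nat_of_bool (if o is Some j then j \in J else false)].
    apply: (den_for (f := f) (I := indep M) (p := Atom (NSet 3 (cell0 5) (NGet 2 (NGet 1 (cell0 5)))))
       (Inv := fun i s => (forall c : 'I_n, (c < i)%N -> nmem s 3 c = (c \in part P J)) /\
     [/\ rmem s 0 0 = rmem st 0 0, stores P s &
         forall o, nmem s 2 (enc o) = nat_of_bool (if o is Some j then j \in J else false)])) => //.
    move=> i s si [hc [hr hp ht]]; split; last by split.
    move=> c; rewrite ltnS leq_eqVlt /= /upd /= si.
    have [/val_inj -> _|nci /= ci] := eqVneq (val c) (val i); last by rewrite hc.
    by rewrite hp ht inE.
  by move=> h [h1 _ _].
rewrite /= /upd /= r2; congr (_ + f _ *+ _).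
by apply/setP=> i; rewrite inE e2 //; case: (_ \in _).
Qed.

Transparent parts_value.

Lemma den_parts_value P st : stores P st ->
  rmem (den (parts_value l') st) 0 0 =
    \sum_(J : {set 'I_l}) (alpha l #|J|)%:R * f (part P J).
Proof.
move=> hP; rewrite -[RHS]big_enum /=.
have [] : stores P (den (parts_value l') st) /\
  rmem (den (parts_value l') st) 0 0 =
    \sum_(J <- enum {set 'I_l}) (alpha l #|J|)%:R * f (part P J); last by [].
rewrite /parts_value /=.
apply: (den_pseq (f := f) (I := indep M) (F := @value_part l') (Inv := fun r s => stores P s /\ rmem s 0 0 =
    \sum_(J <- r) (alpha l #|J|)%:R * f (part P J))).
  by rewrite big_nil.
move=> r J s [hs hr]; split; last first.
  by rewrite (den_value_part _ hs) hr big_rcons /= mulr_natl.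
move=> i; rewrite nmem_den ?hs // /= orbF.
by apply: nwrites_pseq.
Qed.

Opaque parts_value.

(** The invariant of the search: [P] evolves while the size and the two precomputed tables
    persist. *)
Definition ready P st := [/\ nmem st 0 0 = n, stores P st,
  forall i : 'I_n, rmem st 1 i = last_marginal f i & rmem st 2 0 = m].

Lemma ready_nset P st x i v : (1 < x)%N -> ready P st -> ready P (nset st x i v).
Proof. by case: x => [|[|x]] // _ [h0 hP hL hm]. Qed.

Lemma ready_parts_value P st : ready P st -> ready P (den (parts_value l') st).
Proof.
case=> h0 hP hL hm; split=> [|i|i|]; rewrite ?(nmem_den, rmem_den) //;
  by rewrite ?nwrites_parts_value ?rwrites_parts_value.
Qed.

Lemma enc_eq0 o : (enc o == 0%N) = (o == None).
Proof. by case: o. Qed.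

Lemma set_at_stores P st : stores P st -> set_at n st 1 = supp P.
Proof. by move=> hP; apply/setP=> i; rewrite !inE hP enc_eq0. Qed.

Lemma stores_recolor P st (u v : 'I_n) k : stores P st ->
  stores (recolor P u v k) (nset (nset st 1 u 0) 1 v k.+1).
Proof.
move=> hP i; rewrite ffunE /= /upd /= !(inj_eq val_inj).
by case: (i == v) => //; case: (i == u).
Qed.

Lemma beval_guard P st (u v : 'I_n) : ready P st ->
  nmem st 6 0 = u -> nmem st 7 0 = v ->
  beval st guard = (P u != None) && ((P v == None) || (u == v)).
Proof.
move=> [_ hP _ _] hu hv; rewrite /= hu hv !hP !leqn0 !enc_eq0.
by rewrite negb_and !negbK -eqn_leq.
Qed.

Lemma den_PSeq p q st : den (PSeq p q) st = den q (den p st).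
Proof. by []. Qed.

Lemma den_make_move P st (u v : 'I_n) k :
  stores P st -> nmem st 6 0 = u -> nmem st 7 0 = v ->
  den (make_move k) st =
  nset (nset (nset (nset (rset st 3 0 (rmem st 0 0)) 10 0 (enc (P u))) 10 1 (enc (P v)))
    1 u 0) 1 v k.+1.
Proof. by move=> hP hu hv; rewrite /make_move /= /upd /= hu hv !hP. Qed.

Lemma recolor_scaled_gain P (u v : 'I_n) k :
  P u != None -> (P v == None) || (u == v) ->
  scaled_gain f P (recolor P u v k) =
   ((\sum_(J : {set 'I_l}) (alpha l #|J|)%:R * f (part (recolor P u v k) J)
      + last_marginal f v *+ (l * alpha l 1))
   - (\sum_(J : {set 'I_l}) (alpha l #|J|)%:R * f (part P J)
      + last_marginal f u *+ (l * alpha l 1))) *+ n *+ l.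
Proof.
move=> Pu Pv; rewrite /scaled_gain card_ord /potential; congr (_ *+ _ *+ _).
have := sum_supp_recolor f k Pu Pv.
rewrite -[last_marginal f v *+ _]mulr_natl -[last_marginal f u *+ _]mulr_natl.
move: (\sum_(e in supp P) _) (\sum_(e in supp (recolor P u v k)) _) => X Y.
move=> /eqP; rewrite subr_eq => /eqP->; ring.
Qed.

Lemma den_move_and_evaluate P st (u v : 'I_n) k (s := den (move_and_evaluate k) st) :
  ready P st -> nmem st 6 0 = u -> nmem st 7 0 = v ->
  P u != None -> (P v == None) || (u == v) ->
  ready (recolor P u v k) s /\ [/\ nmem s 6 0 = u, nmem s 7 0 = v,
      nmem s 10 0 = enc (P u), nmem s 10 1 = enc (P v) &
      beval s (accept l') = improving f M P u v k].
Proof.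
move=> hr hu hv Pu Pv; rewrite {}/s /move_and_evaluate.
rewrite den_PSeq; have := ready_parts_value hr.
have : [/\ nmem (den (parts_value l') st) 6 0 = u, nmem (den (parts_value l') st) 7 0 = v &
  rmem (den (parts_value l') st) 0 0 = \sum_(J : {set 'I_l}) (alpha l #|J|)%:R * f (part P J)].
  by rewrite !nmem_den ?nwrites_parts_value // (den_parts_value (P := P)) //; case: hr.
move: (den _ st) => s1 [s1u s1v s1r] hr1.
rewrite den_PSeq (den_make_move k (P := P) _ s1u s1v); last by case: hr1.
set s2 := nset _ 1 v k.+1.
have hr2 : ready (recolor P u v k) s2.
  by case: hr1 => h0 hP hL hm; split=> //; apply: stores_recolor.
have [s2u s2v s2r s2a s2b] : [/\ nmem s2 6 0 = u, nmem s2 7 0 = v,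
    rmem s2 3 0 = \sum_(J : {set 'I_l}) (alpha l #|J|)%:R * f (part P J),
    nmem s2 10 0 = enc (P u) & nmem s2 10 1 = enc (P v)] by [].
move: s2 hr2 s2u s2v s2r s2a s2b => s2 hr2 s2u s2v s2r s2a s2b.
rewrite den_PSeq; have := ready_parts_value hr2; set s3 := den _ s2 => hr3.
have s3r : rmem s3 0 0 = \sum_(J : {set 'I_l}) (alpha l #|J|)%:R * f (part (recolor P u v k) J).
  by apply: den_parts_value; case: hr2.
have s3n x j : x \notin [:: 2; 3; 5] -> nmem s3 x j = nmem s2 x j.
  by move=> h; rewrite nmem_den ?nwrites_parts_value.
have s3q : rmem s3 3 0 = \sum_(J : {set 'I_l}) (alpha l #|J|)%:R * f (part P J).
  by rewrite rmem_den ?rwrites_parts_value.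
have [h0 hP hL hm] := hr3.
split; first exact: ready_nset.
split; rewrite /= ?/upd /= ?s3n //.
have -> : nmem s2 0 0 = n by case: hr2.
rewrite s2u s2v s3r s3q !hL hm (set_at_stores hP) leqn0 eqb0 negbK.
by rewrite /improving /legal Pu Pv recolor_scaled_gain.
Qed.

Lemma den_try_move P st (u v : 'I_n) k : ready P st ->
  nmem st 6 0 = u -> nmem st 7 0 = v ->
  ready (if improving f M P u v k then recolor P u v k else P) (den (try_move k) st).
Proof.
move=> hr hu hv; rewrite /try_move.
rewrite -[den _ _]/(if beval st guard then den (PSeq (move_and_evaluate k) (PIf (accept l') (Atom Skip) undo_move)) st else st).
rewrite (beval_guard hr hu hv).
have [/andP[Pu Pv]|/negbTE g] := boolP (_ && _); last by rewrite /improving /legal andbA g.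
have [] := den_move_and_evaluate k hr hu hv Pu Pv.
rewrite den_PSeq; move: (den _ st) => s hs [su sv sa sb acc].
rewrite -[den _ _]/(if beval s (accept l') then s else den undo_move s) acc.
case: ifP => // _; case: hs => h0 hP hL hm.
split=> //; move=> i; rewrite /= /upd /= su sv sa sb.
rewrite !(inj_eq val_inj); case: (eqVneq i u) => [-> //|iu].
case: (eqVneq i v) => [-> //|iv].
by rewrite hP ffunE (negbTE iu) (negbTE iv).
Qed.

End Correctness.

(** * Progress of the local search *)

Section Search.
Variables (R : realType) (n l' : nat) (f : {set 'I_n} -> R) (M : matroid 'I_n).
Hypotheses (f_sub : submodular f) (f_mon : monotone f).
Hypothesis f_ge0 : forall S, 0 <= f S.
Local Notation l := l'.+1.
Local Notation state := (state R).
Local Notation den := (den f (indep M)).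
Local Notation m := (max_single f M).
Implicit Types (P Q S : {ffun 'I_n -> option 'I_l}) (st s : state).
Implicit Types (A B : 'I_n -> 'I_n -> 'I_l -> Prop).

(** [A] describes the moves tried so far. Either all of them failed and nothing changed, or the
    potential rose by at least one threshold; this dichotomy is preserved under composition. *)
Definition advances A P Q :=
  base_coloring M Q /\
  ((Q = P /\ forall u v k, A u v k -> ~~ improving f M P u v k) \/
   (~ stable f M P /\ m <= scaled_gain f P Q)).

Lemma scaled_gain_trans P Q S :
  scaled_gain f P S = scaled_gain f P Q + scaled_gain f Q S.
Proof. by rewrite /scaled_gain -!mulrnDl addrC addrA subrK. Qed.

Lemma advances_trans A B P Q S :
  advances A P Q -> advances B Q S -> advances (fun u v k => A u v k \/ B u v k) P S.
Proof.
have m0 := max_single_ge0 f M.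
move=> [bQ h1] [bS h2]; split=> //.
move: h2; case: h1 => [[-> hA] | [nP gPQ]] h2.
  case: h2 => [[-> hB] | h2]; last by right.
  by left; split=> // u v k [/hA|/hB].
right; split=> //; rewrite (scaled_gain_trans P Q).
case: h2 => [[-> _] | [_ h2]]; last by apply: le_trans gPQ _; rewrite lerDl (le_trans m0).
by rewrite /scaled_gain subrr !mul0rn addr0.
Qed.

Lemma advances_weaken A B P Q :
  (forall u v k, B u v k -> A u v k) -> advances A P Q -> advances B P Q.
Proof.
move=> AB [bQ [[E hA] | h]]; split=> //; last by right.
by left; split=> // u v k /AB/hA.
Qed.

Lemma advances_refl A P : base_coloring M P -> (forall u v k, ~ A u v k) -> advances A P P.
Proof. by move=> bP hA; split=> //; left; split=> // u v k /hA. Qed.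

Lemma advances_move P u v k : base_coloring M P ->
  advances (fun u' v' k' => [/\ u' = u, v' = v & k' = k]) P
    (if improving f M P u v k then recolor P u v k else P).
Proof.
move=> bP; case: ifP => imp; last first.
  by split=> //; left; split=> // _ _ _ [-> -> ->]; rewrite imp.
have /andP[/and3P[Pu Pv iQ] gain] := imp; split.
  by split=> // T iT; rewrite card_supp_recolor //; case: bP => _; apply.
by right; split=> // /(_ u v k); rewrite imp.
Qed.

Local Notation reaches A P s := (exists Q, ready f M Q s /\ advances A P Q).

Lemma advances_base A P Q : advances A P Q -> base_coloring M Q.
Proof. by case. Qed.

(** The set of tried moves grows along the three nested loops until it contains every move. *)
Lemma den_scan P st : ready f M P st -> base_coloring M P ->
  reaches (fun _ _ _ => True) P (den (scan l') st).
Proof.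
move=> hr bP; rewrite /scan.
suff [Q [rQ aQ]] : reaches (fun u v k => (u < n)%N) P (den (scan l') st).
  by exists Q; split=> //; apply: advances_weaken aQ.
apply: (den_for (Inv := fun i s => reaches (fun u v k => (u < i)%N) P s)) => //=.
- by rewrite nwrites_pseq // => k; apply: nwrites_try_move.
- by exists P; split; [exact: ready_nset | exact: advances_refl].
move=> u s su [Q [rQ aQ]].
suff [S [rS aS]] : reaches (fun u' v k => u' = u) Q
   (den (PFor 7 (pseq [seq try_move k | k <- enum 'I_l])) s).
  exists S; split; first exact: ready_nset.
  apply: advances_weaken (advances_trans aQ aS) => u' v k.
  by rewrite ltnS leq_eqVlt => /orP[/eqP/val_inj->|]; auto.
have {bP} bQ := advances_base aQ; move: rQ; clear aQ => rQ.
suff [_ [S [rS aS]]] : nmem (den (PFor 7 (pseq [seq try_move k | k <- enum 'I_l])) s) 6 0 = u /\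
    reaches (fun u' v k => u' = u /\ (v < n)%N) Q
    (den (PFor 7 (pseq [seq try_move k | k <- enum 'I_l])) s).
  by exists S; split=> //; apply: advances_weaken aS => u' v k; split.
apply: (den_for (Inv := fun i s => nmem s 6 0 = u /\
  reaches (fun u' v k => u' = u /\ (v < i)%N) Q s)) => //=.
- by rewrite nwrites_pseq // => k; apply: nwrites_try_move.
- split=> //; exists Q; split; [exact: ready_nset | apply: advances_refl => //].
  by move=> ? ? ? [].
clear s su rQ => v s sv [su [S [rS aS]]].
suff [tu [_ [T [rT aT]]]] : nmem (den (pseq [seq try_move k | k <- enum 'I_l]) s) 6 0 = u /\
    (nmem (den (pseq [seq try_move k | k <- enum 'I_l]) s) 7 0 = v /\
    reaches (fun u' v' k => [/\ u' = u, v' = v & k \in enum 'I_l]) S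
    (den (pseq [seq try_move k | k <- enum 'I_l]) s)).
  split=> //; exists T; split; first exact: ready_nset.
  apply: advances_weaken (advances_trans aS aT) => u' v' k [->].
  rewrite ltnS leq_eqVlt => /orP[/eqP/val_inj->|]; last by auto.
  by right; rewrite mem_enum.
apply: (@den_pseq R n f (indep M) _ (@try_move l') (fun r s => nmem s 6 0 = u /\
   (nmem s 7 0 = v /\ reaches (fun u' v' k => [/\ u' = u, v' = v & k \in r]) S s))).
  split=> //; split=> //; exists S; split=> //; apply: advances_refl.
    exact: advances_base aS.
  by move=> ? ? ? [].
clear s su sv rS => r k s [su [sv [T [rT aT]]]].
split; first by rewrite nmem_den // nwrites_try_move.
split; first by rewrite nmem_den // nwrites_try_move.
exists (if improving f M T u v k then recolor T u v k else T).
split; first exact: den_try_move.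
apply: advances_weaken (advances_trans aT (advances_move u v k (advances_base aT))).
move=> u' v' k' [-> ->]; rewrite mem_rcons inE => /orP[/eqP->|]; first by right.
by left.
Qed.

(** The state after [c] scans: each scan that does not start from a stable coloring has gained a
    threshold. *)
Definition searched (c : nat) P := base_coloring M P /\
  (stable f M P \/ m *+ c <= potential f P *+ n *+ l).

Lemma searched_scan c P Q : searched c P -> advances (fun _ _ _ => True) P Q -> searched c.+1 Q.
Proof.
case=> bP h [bQ [[-> stP] | [nst gain]]]; split=> //; first by left=> u v k; apply: stP.
case: h => // h; right; move: gain h; rewrite /scaled_gain card_ord !mulrnBl [m *+ c.+1]mulrS.
by move: (potential f P *+ n *+ l) (potential f Q *+ n *+ l) (m *+ c) => x y z; lra.
Qed.

Lemma den_local_search r P st : ready f M P st -> base_coloring M P ->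
  exists Q, ready f M Q (den (local_search l' r) st) /\ searched (n * (n * r)) Q.
Proof.
move=> hr bP; rewrite /local_search.
have ns x : x \notin [:: 1; 2; 3; 4; 5; 6; 7; 10] ->
    nwrites (pseq [seq scan l' | _ <- iota 0 r]) x = false.
  by move=> h; apply: nwrites_pseq => _; apply: nwrites_scan.
apply: (den_for (Inv := fun a s => exists Q, ready f M Q s /\ searched (a * (n * r)) Q)).
- by rewrite /= ns.
- exists P; split; first exact: ready_nset.
  split=> //; right; rewrite mul0n mulr0n; apply: mulrn_wge0; apply: mulrn_wge0.
  exact: potential_ge0.
clear hr bP => a s _ [P' [hr hs]].
suff [Q [rQ sQ]] : exists Q, ready f M Q (den (PFor 9 (pseq [seq scan l' | _ <- iota 0 r])) s)
    /\ searched (a * (n * r) + n * r) Q.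
  by exists Q; split; [exact: ready_nset | rewrite mulSn addnC].
apply: (den_for (Inv := fun b s => exists Q, ready f M Q s /\ searched (a * (n * r) + b * r) Q)).
- by rewrite ns.
- by exists P'; split; [exact: ready_nset | rewrite mul0n addn0].
clear s P' hr hs => b s _ [P' [hr hs]].
suff [Q [rQ sQ]] : exists Q, ready f M Q (den (pseq [seq scan l' | _ <- iota 0 r]) s)
    /\ searched (a * (n * r) + b * r + size (iota 0 r)) Q.
  by exists Q; split; [exact: ready_nset | move: sQ; rewrite size_iota mulSn -addnA [(r + _)%N]addnC].
apply: (@den_pseq R n f (indep M) _ (fun=> scan l') (fun q s => exists Q, ready f M Q s
   /\ searched (a * (n * r) + b * r + size q) Q)).
  by exists P'; rewrite addn0.
clear s P' hr hs => q j s [P' [hr hs]].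
have [Q [rQ aQ]] := den_scan hr (proj1 hs).
by exists Q; split=> //; rewrite size_rcons addnS; apply: searched_scan aQ.
Qed.

(** So many gains would push the potential above the bound of [potential_le], so the coloring is
    stable. An empty base and [m = 0] are treated apart. *)
Lemma searched_guarantee P : searched (n * (n * (weight_bound l' * l).+1)) P ->
  curvature f <= 1 ->
  f (supp P) >= (1 - curvature f / expR 1 - 2%:R / l%:R)
     * \big[Num.max/f set0]_(T : {set 'I_n} | indep M T) f T.
Proof.
move=> [bP hP] k1; have [iP _] := bP.
have [S0|S0] := eqVneq (supp P) set0.
  apply: stable_guarantee => // u v k; apply/negP=> /andP[/and3P[Pu _ _] _].
  have : u \in supp P by rewrite inE.
  by rewrite S0 inE.
have m0 : 0 <= m := max_single_ge0 f M.
(* With threshold 0 accepted moves need not make progress, but then no nonempty independent set has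
   positive value and any output is optimal. *)
move: m0; rewrite le_eqVlt => /orP[/eqP m0 | m0].
  have le1 : 1 - curvature f / expR 1 - 2%:R / l%:R <= 1.
    have /andP[k0 _] := curvature_bounds f_mon.
    rewrite -addrA gerDl -opprD oppr_le0.
    by apply: addr_ge0; rewrite divr_ge0 ?expR_ge0.
  apply: (@le_trans _ _ (\big[Num.max/f set0]_(T : {set 'I_n} | indep M T) f T)).
    by apply: ler_piMl => //; apply: le_trans (f_ge0 set0) (bigmax_ge_id _ _ _ _).
  apply: bigmax_le => [|T iT]; first by apply: f_mon; apply: sub0set.
  have [->|T0] := eqVneq T set0; first by apply: f_mon; apply: sub0set.
  apply: (@le_trans _ _ 0); last exact: f_ge0.
  apply: le_trans (indep_le_max_single f_sub f_mon f_ge0 iT T0) _.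
  by rewrite -m0 mul0rn.
case: hP => [st|hle]; first exact: stable_guarantee.
have n0 : (0 < n)%N by case/set0Pn: S0 => u _; apply: leq_ltn_trans (ltn_ord u).
suff : potential f P *+ n *+ l < m *+ (n * (n * (weight_bound l' * l).+1)) by rewrite ltNge hle.
apply: (@le_lt_trans _ _ (m *+ n *+ weight_bound l' *+ n *+ l)).
  by rewrite !lerMn2r; do 2!(apply/orP; right); have := (potential_le f_sub f_mon f_ge0 iP S0); rewrite card_ord.
rewrite -!mulrnA ltr_pMn2l //.
nia.
Qed.

End Search.

(** * Greedy base and precomputed tables *)

Section Initialization.
Variables (R : realType) (n : nat) (f : {set 'I_n} -> R) (M : matroid 'I_n).
Local Notation state := (state R).
Local Notation I := (indep M).
Local Notation den := (den f I).
Implicit Types (st s : state) (A : {set 'I_n}).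

(** A rejected element stays rejected as [A] grows, so the final set is maximal, and by augmentation
    of maximum size. *)
Lemma den_init_base st : (forall i : 'I_n, nmem st 1 i = 0%N) ->
  exists A, [/\ I A, forall T, I T -> (#|T| <= #|A|)%N &
    forall i : 'I_n, nmem (den init_base st) 1 i = (i \in A)].
Proof.
move=> st1.
have [A [iA maxA memA _]] : exists A, [/\ I A,
    forall e : 'I_n, (e < n)%N -> e \notin A -> ~~ I (e |: A),
    forall i : 'I_n, nmem (den init_base st) 1 i = (i \in A) &
    forall e : 'I_n, (n <= e)%N -> e \notin A].
  rewrite /init_base; apply: (den_for (Inv := fun i s => exists A, [/\ I A,
    forall e : 'I_n, (e < i)%N -> e \notin A -> ~~ I (e |: A),
    forall i : 'I_n, nmem s 1 i = (i \in A) &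
    forall e : 'I_n, (i <= e)%N -> e \notin A])) => //.
    exists set0; split; [exact: indep0 | by [] | | by move=> e _; rewrite inE].
    by move=> i; rewrite inE; apply: st1.
  move=> i s si [A [iA maxA memA outA]].
  have iA' : i \notin A by apply: outA.
  have setE : set_at n (nset s 1 i 1) 1 = i |: A.
    apply/setP=> j; rewrite !inE /= /upd /= (inj_eq val_inj).
    by case: (j == i) => //=; rewrite memA eqb0 negbK.
  rewrite -[den _ s]/(let s' := nset (nset s 1 (nmem s 5 0) 1) 4 0 (I (set_at n (nset s 1 (nmem s 5 0) 1) 1)) in
     if beval s' (nzero (cell0 4)) then nset s' 1 (nmem s' 5 0) 0 else s').
  rewrite si setE /= /upd /=; have [iiA|niA] := boolP (I (i |: A)).
    exists (i |: A); split=> // [e|j|e].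
    - rewrite ltnS leq_eqVlt in_setU1 negb_or => /orP[/eqP/val_inj->|ei /andP[_ eA]].
        by rewrite eqxx.
      by apply: contra (maxA e ei eA); apply: indep_sub; rewrite setUCA subsetUr.
    - by rewrite in_setU1 /= /upd /= (inj_eq val_inj); case: (j == i) => //=.
    - move=> ie; rewrite in_setU1 negb_or outA ?(ltnW ie) // andbT.
      by apply: contraTneq ie => ->; rewrite ltnn.
  exists A; split=> // [e|j|e ie]; last by rewrite outA // ltnW.
    by rewrite ltnS leq_eqVlt => /orP[/eqP/val_inj->//|]; apply: maxA.
  rewrite /= /upd /= si !(inj_eq val_inj).
  by have [->|ji] := eqVneq j i; rewrite ?(negbTE iA') //.
exists A; split=> // T iT; rewrite leqNgt; apply/negP=> ltA.
have [e /setDP[_ eA] ieA] := indep_aug iA iT ltA.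
by have := maxA e (ltn_ord e) eA; rewrite ieA.
Qed.

Lemma den_init_marginals st (i : 'I_n) :
  rmem (den init_marginals st) 1 i = last_marginal f i.
Proof.
rewrite /init_marginals.
set p1 := PFor 5 (Atom _); set p2 := PSeq (Atom (NSet 12 _ (NConst 0))) _.
rewrite !den_PSeq.
have full : forall i : 'I_n, (i < n)%N -> nmem (den p1 st) 12 i = 1%N.
  apply: (den_for (Inv := fun c s => forall i : 'I_n, (i < c)%N -> nmem s 12 i = 1%N)) => //.
  move=> c s sc h j; rewrite ltnS leq_eqVlt /= /upd /= sc (inj_eq val_inj).
  by case: (eqVneq j c) => //= _ /h.
move: (den p1 st) full => s0 full.
have fullT s : (forall j : 'I_n, nmem s 12 j = 1%N) -> set_at n s 12 = setT.
  by move=> h; apply/setP=> j; rewrite !inE h.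
set s1 := den (Atom _) s0.
have s1T : rmem s1 0 1 = f setT by rewrite /= /upd /= fullT // => j; apply: full.
have [h _] : (forall i : 'I_n, (i < n)%N -> rmem (den (PFor 5 p2) s1) 1 i = last_marginal f i) /\
   ((forall j : 'I_n, nmem (den (PFor 5 p2) s1) 12 j = 1%N) /\
    rmem (den (PFor 5 p2) s1) 0 1 = f setT); last exact: (h i (ltn_ord i)).
apply: (den_for (Inv := fun c s =>
  (forall i : 'I_n, (i < c)%N -> rmem s 1 i = last_marginal f i) /\
  ((forall j : 'I_n, nmem s 12 j = 1%N) /\ rmem s 0 1 = f setT))) => //.
  by split=> //; split=> // j; rewrite /= /upd /= -[LHS]/(nmem s0 12 j) full.
move=> c s sc [h [h12 hT]].
have setE : set_at n (nset s 12 c 0) 12 = setT :\ c.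
  apply/setP=> j; rewrite !inE /= /upd /= (inj_eq val_inj).
  by case: (j == c) => //=; rewrite h12.
split; last split=> [j|].
- move=> j; rewrite ltnS leq_eqVlt /= /upd /= sc hT (inj_eq val_inj) setE.
  by have [->|jc /h ->] := eqVneq j c.
- by rewrite /= /upd /= sc (inj_eq val_inj) h12; case: (j == c).
- by rewrite /= /upd /= hT.
Qed.

Lemma den_init_single st : (forall i : 'I_n, nmem st 11 i = 0%N) -> rmem st 2 0 = 0 ->
  rmem (den init_single st) 2 0 = max_single f M.
Proof.
move=> h11 h2; rewrite /init_single /max_single.
set p := PSeq _ _.
have [-> _] : rmem (den (PFor 5 p) st) 2 0 =
    \big[Num.max/0]_(e : 'I_n | (e < n)%N && I [set e]) f [set e] /\
    (forall j : 'I_n, nmem (den (PFor 5 p) st) 11 j = 0%N); last first.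
  by apply: eq_bigl => e; rewrite ltn_ord.
apply: (den_for (Inv := fun c s => rmem s 2 0 =
    \big[Num.max/0]_(e : 'I_n | (e < c)%N && I [set e]) f [set e] /\
    (forall j : 'I_n, nmem s 11 j = 0%N))) => //.
  by split=> //; rewrite big_pred0 // => e; rewrite ltn0.
move=> c s sc [hM h].
have setE : set_at n (nset s 11 c 1) 11 = [set c].
  apply/setP=> j; rewrite !inE /= /upd /= (inj_eq val_inj).
  by case: (j == c) => //=; rewrite h.
have old : \big[Num.max/0]_(e : 'I_n | (e < c.+1)%N && I [set e] && (e != c)) f [set e]
    = rmem s 2 0.
  rewrite hM; apply: eq_bigl => e; rewrite ltnS leq_eqVlt (inj_eq val_inj) andbAC.
  by congr (_ && _); case: (eqVneq e c) => [->|_]; rewrite ?ltnn ?andbF ?andbT.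
have setE' v : set_at n (nset (nset s 11 c 1) 4 0 v) 11 = [set c] := setE.
rewrite /p; split=> [|j]; last first.
  rewrite !den_PSeq; set t := den (PIf _ _ _) _.
  have t5 : nmem t 5 0 = c by rewrite nmem_den.
  have t11 : nmem t 11 j = (j == c).
    by rewrite nmem_den //= /upd /= sc (inj_eq val_inj) h; case: (j == c).
  by rewrite /= /upd /= t5 (inj_eq val_inj) t11; case: (j == c).
rewrite /= /upd /= sc !setE' !setE leqn0 eqb0 negbK -ltNge.
have [Ic|nIc] := boolP (I [set c]).
  rewrite (bigmaxD1 c) ?ltnSn //= old maxC /Order.max.
  by case: ifP.
rewrite /= /upd /= -old; apply: eq_bigl => e; rewrite andbAC -andbA.
by have [->|_] := eqVneq e c; rewrite ?andbT ?(negbTE nIc) ?andbF.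
Qed.

End Initialization.

(** * Assembly of the algorithm and its guarantee *)

Theorem theorem1 (R : realType) (eps : R) (eps_gt0 : 0 < eps) :
  exists (A : cmd) (p : {poly nat}),
    forall (n : nat) (f : {set 'I_n} -> R) (M : matroid 'I_n),
      (forall S : {set 'I_n}, 0 <= f S) ->
      submodular f -> monotone f -> 0 <= curvature f <= 1 ->
      exists (t : nat) (S : {set 'I_n}),
        [/\ outputs f (indep M) A t S,
            (t <= p.[n])%N,
            indep M S &
            f S >= (1 - curvature f / expR 1 - eps)
                   * \big[Num.max/f set0]_(T : {set 'I_n} | indep M T) f T].
Proof.
(* Chosen so that the loss [2/l] of [searched_guarantee] is at most [eps]. *)
pose l' := Num.bound (2%:R / eps).
have l_eps : 2%:R / l'.+1%:R <= eps.
  rewrite ler_pdivrMr ?ltr0n // mulrC -ler_pdivrMr //.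
  have : 2%:R / eps < l'%:R by apply: archi_boundP; rewrite divr_ge0 // ltW.
  by move/ltW/le_trans; apply; rewrite ler_nat.
(* The repetition count depends on [eps] only; the two outer loops multiply it by n^2. *)
pose A := main_prog l' (weight_bound l' * l'.+1).+1.
exists (code A), (cost A) => n f M f_ge0 f_sub f_mon /andP[k0 k1].
have [wfA wA] := well_formed_main l' (weight_bound l' * l'.+1).+1.
have [t ex le_t] := exec_den f (indep M) wfA wA (erefl : nmem (init R n) 0 0 = n).
set st := den f (indep M) A (init R n) in ex.
have [B [iB maxB sB]] := @den_init_base R n f M (init R n) (fun=> erefl).
set s1 := den f (indep M) init_base (init R n) in sB.
pose s2 := den f (indep M) init_marginals s1.
pose s3 := den f (indep M) init_single s2.
have s3L (i : 'I_n) : rmem s3 1 i = last_marginal f i.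
  by rewrite rmem_den // den_init_marginals.
have s3m : rmem s3 2 0 = max_single f M.
  by apply: den_init_single => [i|]; rewrite ?nmem_den ?rmem_den.
pose P : {ffun 'I_n -> option 'I_l'.+1} := [ffun i => if i \in B then Some ord0 else None].
have hP : ready f M P s3.
  split=> // [|i]; first by rewrite !nmem_den.
  rewrite (@nmem_den _ _ _ _ init_single) // (@nmem_den _ _ _ _ init_marginals) //.
  by rewrite sB ffunE; case: (i \in B).
have suppP : supp P = B by apply/setP=> i; rewrite inE ffunE; case: (i \in B).
have bP : base_coloring M P by split; rewrite suppP.
have [Q [[_ stQ _ _] sQ]] := den_local_search f_mon f_ge0 (weight_bound l' * l'.+1).+1 hP bP.
exists t, (supp Q); split=> //; first by exists st => //; apply: set_at_stores.
  by case: sQ => [[]].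
have H := searched_guarantee f_sub f_mon f_ge0 sQ k1.
apply: le_trans H; apply: ler_wpM2r; last by rewrite lerD2l lerN2.
exact: le_trans (f_ge0 set0) (bigmax_ge_id _ _ _ _).
Qed.
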